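(* Let $p$ be an asymptotically isothermal pressure law with entropy kernel $\chi(\rho,u)$. Given any $(\rho_0,u_0)$ with $u_0\in[-k(\rho_0),k(\rho_0)]$ and any $0<\rho_*<\rho_0$, we have $$\begin{aligned}\chi(\rho_0,u_0)=&\ \frac{1}{2(\rho_0-\rho_* )k'(\rho_0)}\int_{\rho_*}^{\rho_0}k'(\rho)d(\rho)\,\chi(\rho,u_0+k(\rho_0)-k(\rho))\,d\rho\\&+\frac{1}{2(\rho_0-\rho_* )k'(\rho_0)}\int_{\rho_*}^{\rho_0}k'(\rho)d(\rho)\,\chi(\rho,u_0-k(\rho_0)+k(\rho))\,d\rho\\&-\frac{1}{2(\rho_0-\rho_* )k'(\rho_0)}\int_{-(k(\rho_0)-k(\rho_* ))}^{k(\rho_0)-k(\rho_* )}\chi(\rho_*,u_0-y)\,dy,\end{aligned}$$ where $d(\rho)=2+(\rho-\rho_* )\frac{k''(\rho)}{k'(\rho)}$.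
   Context: Asymptotically isothermal pressure law: (1) $p\in C^1([0,\infty))\cap C^4((0,\infty))$, $p(\rho)>0$, $p'(\rho)>0$ and $\rho p''(\rho)+2p'(\rho)>0$ for all $\rho>0$. (2) There are $\gamma\in(1,3)$, $\kappa_1>0$, $r>0$, $C_r>0$ and $P\in C^4((0,\infty))$ with $p(\rho)=\kappa_1\rho^\gamma(1+P(\rho))$ for $\rho\in[0,r)$ and $|P^{(j)}(\rho)|\le C_r\rho^{2\theta-j}$ for $\rho\in(0,r)$, $j\in\{0,\dots,4\}$, where $\theta=\frac{\gamma-1}{2}$. (3) There are $\alpha>0$, $\kappa_2>0$, $C_p>0$, $R>0$ with $\big|\big(\frac{p(\rho)}{\rho}-\kappa_2\big)^{(j)}\big|\le C_p\rho^{-\alpha-j}$ for $\rho\ge R$, $j\in\{0,\dots,4\}$. Notation: $k(\rho)=\int_0^\rho\frac{\sqrt{p'(y)}}{y}\,dy$. The entropy kernel $\chi(\rho,u)$ is the unique (Hölder continuous) solution of $\chi_{\rho\rho}-k'(\rho)^2\chi_{uu}=0$, $\chi(0,u)=0$, $\chi_\rho(0,u)=\delta_{u=0}$; it is known that $\operatorname{supp}\chi(\rho,\cdot)=[-k(\rho),k(\rho)]$. *)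

(* Defs.v *)
From Stdlib Require Import Reals.
From Coquelicot Require Import Coquelicot.

Open Scope R_scope.

Definition Ck_pos (n : nat) (f : R -> R) : Prop :=
  forall (j : nat) (x : R), (j <= n)%nat -> 0 < x ->
    ex_derive_n f j x /\ continuous (Derive_n f j) x.

(* [f] is only meaningful on [0,oo): the derivative at 0 is one-sided. *)
Definition C1_nonneg (f : R -> R) : Prop :=
  Ck_pos 1 f /\
  filterlim f (at_right 0) (locally (f 0)) /\
  exists l : R,
    filterlim (fun h => (f h - f 0) / h) (at_right 0) (locally l) /\
    filterlim (Derive f) (at_right 0) (locally l).

(* The powers are [Rpower], whose value at base 0 is 1, so the identity
   p = kappa1 rho^gamma (1 + P) is split into rho = 0 and 0 < rho < r. *)
Definition asymptotically_isothermal (p : R -> R) : Prop :=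
  (C1_nonneg p /\ Ck_pos 4 p /\
   forall rho, 0 < rho ->
     0 < p rho /\ 0 < Derive p rho /\
     0 < rho * Derive_n p 2 rho + 2 * Derive p rho) /\
  (exists (gamma kappa1 r Cr : R) (P : R -> R),
     1 < gamma < 3 /\ 0 < kappa1 /\ 0 < r /\ 0 < Cr /\ Ck_pos 4 P /\
     p 0 = 0 /\
     (forall rho, 0 < rho < r ->
        p rho = kappa1 * Rpower rho gamma * (1 + P rho)) /\
     (forall (j : nat) (rho : R), (j <= 4)%nat -> 0 < rho < r ->
        let theta := (gamma - 1) / 2 in
        Rabs (Derive_n P j rho) <= Cr * Rpower rho (2 * theta - INR j))) /\
  (exists alpha kappa2 Cp Rb : R,
     0 < alpha /\ 0 < kappa2 /\ 0 < Cp /\ 0 < Rb /\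
     forall (j : nat) (rho : R), (j <= 4)%nat -> Rb <= rho ->
       Rabs (Derive_n (fun y => p y / y - kappa2) j rho)
       <= Cp * Rpower rho (- alpha - INR j)).

(* Improper at 0, where the integrand may blow up; used for [0 < rho] only. *)
Definition k (p : R -> R) (rho : R) : R :=
  RInt_gen (fun y => sqrt (Derive p y) / y) (at_right 0) (at_point rho).

(* phi in C_c^oo((0,oo) x R), with support in [a,b] x [-M,M]. *)
Definition test_fun2 (a b M : R) (phi : R -> R -> R) : Prop :=
  0 < a < b /\ 0 < M /\
  (forall (n : nat) (rho u : R), ex_diff_n phi n rho u) /\
  (forall rho u, phi rho u <> 0 -> a <= rho <= b /\ - M <= u <= M).

(* psi in C_c^oo(R), with support in [-M,M]. *)
Definition test_fun1 (M : R) (psi : R -> R) : Prop :=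
  0 < M /\
  (forall (n : nat) (u : R), ex_derive_n psi n u) /\
  (forall u, psi u <> 0 -> - M <= u <= M).

(* Distance 0 is harmless despite [Rpower 0 a = 1]: the left side is then 0. *)
Definition locally_Holder (chi : R -> R -> R) : Prop :=
  forall M : R, 0 < M ->
    exists a C : R, 0 < a <= 1 /\ 0 <= C /\
      forall rho1 rho2 u1 u2 : R,
        0 <= rho1 <= M -> 0 <= rho2 <= M ->
        - M <= u1 <= M -> - M <= u2 <= M ->
        Rabs (chi rho1 u1 - chi rho2 u2)
        <= C * Rpower (Rabs (rho1 - rho2) + Rabs (u1 - u2)) a.

(* chi_rr - k'^2 chi_uu = 0 in the sense of distributions on (0,oo) x R. *)
Definition entropy_equation (p : R -> R) (chi : R -> R -> R) : Prop :=
  forall (a b M : R) (phi : R -> R -> R), test_fun2 a b M phi ->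
    RInt (fun rho =>
      RInt (fun u =>
        chi rho u * (partial_derive 2 0 phi rho u
                     - (Derive (k p) rho) ^ 2 * partial_derive 0 2 phi rho u))
        (- M) M) a b = 0.

(* chi_r(0, .) = delta_0: the difference quotients of rho |-> chi(rho, .) at
   rho = 0+ converge to delta_0 as distributions in u. *)
Definition initial_velocity_dirac (chi : R -> R -> R) : Prop :=
  forall (M : R) (psi : R -> R), test_fun1 M psi ->
    filterlim
      (fun rho => RInt (fun u => (chi rho u - chi 0 u) / rho * psi u) (- M) M)
      (at_right 0) (locally (psi 0)).

(* [chi] is only meaningful on [0,oo) x R. *)
Definition entropy_kernel (p : R -> R) (chi : R -> R -> R) : Prop :=
  locally_Holder chi /\
  entropy_equation p chi /\
  (forall u, chi 0 u = 0) /\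
  initial_velocity_dirac chi.

Definition d (p : R -> R) (rhos rho : R) : R :=
  2 + (rho - rhos) * (Derive_n (k p) 2 rho / Derive (k p) rho).

(* Main.v *)
Require Import Defs.
From Stdlib Require Import Reals Lra Lia FunctionalExtensionality Classical_Prop.
From Coquelicot Require Import Coquelicot.

Open Scope R_scope.

(** If [chi] were smooth, the identity would be the divergence theorem.
    Multiplied by [rho - rhos], the equation reads
    [((rho - rhos) chi_rho - chi)_rho - ((rho - rhos) k'^2 chi_u)_u = 0];
    integrated over the triangle bounded by [rho = rhos] and by the two
    characteristics [u = u0 +- (k rho0 - k rho)] through [(rho0, u0)], it
    leaves the integral of [chi rhos] over the base and, on each side, the
    integral of [k' ((rho - rhos) D chi - chi)], where [D] is the derivative
    along the characteristic. Integrating by parts along the side moves [D] to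
    the weight, which becomes [k' d], and produces the value at the apex. The
    computation is [triangle_identity], where the triangle is swept by its
    horizontal sections: the integral over the section at height [rho], plus
    boundary terms, has the integrand of the right-hand side as derivative.

    But [chi] is only continuous and solves the equation in the sense of
    distributions. Its coefficients depend on [rho] alone, so mollifying [chi]
    in [u] commutes with the equation, and the mollified function [X] is smooth
    in [u]. Testing with products [phi rho * eta (v - u)] shows that, for each
    [v], [X_rhorho = k'^2 X_uu] holds as distributions in [rho]. The right-hand
    side is continuous, hence [X] is of class C2 in [rho] and the equation holds
    classically: [second_derivative_of_distributional], proved by a second
    mollification, in one variable. The mollified functions converge to [chi]
    uniformly on the triangle, and every term of the identity is continuous for
    uniform convergence ([domain_of_dependence_identity]).

    The regularity of [k] is the other ingredient. The bounds on [P] give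
    [sqrt p' / rho = O(rho^(theta - 1))] near the vacuum, which is integrable,
    so the improper integral defining [k] converges and [k] is of class C2 on
    the open half-line ([k_regular]). *)

(** * Smooth functions and mollifiers *)

Fixpoint Cn (n : nat) (f : R -> R) : Prop :=
  (forall x, continuous f x) /\
  match n with
  | O => True
  | S m => (forall x, ex_derive f x) /\ Cn m (Derive f)
  end.

Definition smooth (f : R -> R) : Prop := forall n, Cn n f.

Lemma Cn_S n : forall f, Cn (S n) f -> Cn n f.
Proof.
  induction n as [|n IH]; intros f [Hc [He HD]]; split; auto.
Qed.

Lemma Cn_is_derive n (f f' : R -> R) :
  (forall x, is_derive f x (f' x)) -> Cn n f' -> Cn (S n) f.
Proof.
  intros Hd Hf'.
  assert (HD : Derive f = f') by
    (apply functional_extensionality; intro x; apply is_derive_unique, Hd).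
  split; [|split].
  - intro x; apply (ex_derive_continuous f); exists (f' x); apply Hd.
  - intro x; exists (f' x); apply Hd.
  - rewrite HD; exact Hf'.
Qed.

Lemma Cn_plus n : forall f g, Cn n f -> Cn n g -> Cn n (fun x => f x + g x).
Proof.
  induction n as [|n IH]; intros f g Hf Hg.
  - split; auto. intro x.
    apply (continuous_plus f g); [apply Hf|apply Hg].
  - apply Cn_is_derive with (fun x => Derive f x + Derive g x).
    + intro x. apply (is_derive_plus f g); apply Derive_correct; [apply Hf|apply Hg].
    + apply IH; [apply Hf|apply Hg].
Qed.

Lemma Cn_mult n : forall f g, Cn n f -> Cn n g -> Cn n (fun x => f x * g x).
Proof.
  induction n as [|n IH]; intros f g Hf Hg.
  - split; auto. intro x.
    apply (continuous_mult f g); [apply Hf|apply Hg].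
  - apply Cn_is_derive with (fun x => Derive f x * g x + f x * Derive g x).
    + intro x.
      apply (is_derive_mult f g x); try (apply Derive_correct; [apply Hf|apply Hg]);
        [apply Derive_correct, Hf|apply Derive_correct, Hg|intros; apply Rmult_comm].
    + apply Cn_plus; apply IH; try apply Hf; try apply Hg; apply Cn_S; assumption.
Qed.

Lemma Cn_const n c : Cn n (fun _ => c).
Proof.
  revert c; induction n as [|n IH]; intro c.
  - split; auto; intro x; apply continuous_const.
  - apply Cn_is_derive with (fun _ => 0); auto.
    intro x; apply (is_derive_const c x).
Qed.

Lemma Cn_comp_affine n a b :
  forall f, Cn n f -> Cn n (fun x => f (a * x + b)).
Proof.
  induction n as [|n IH]; intros f Hf.
  - split; auto. intro x.
    apply (continuous_comp (fun x => a * x + b) f).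
    + apply (ex_derive_continuous (fun x : R => a * x + b)). auto_derive; auto.
    + apply Hf.
  - apply Cn_is_derive with (fun x => a * Derive f (a * x + b)).
    + intro x. apply (is_derive_comp f (fun x => a * x + b)).
      * apply Derive_correct, Hf.
      * auto_derive; auto; ring.
    + apply Cn_mult; [apply Cn_const|apply (IH (Derive f)), Hf].
Qed.

Lemma smooth_ex_derive f x : smooth f -> ex_derive f x.
Proof. intros H; apply (H 1%nat). Qed.

Lemma smooth_continuous f x : smooth f -> continuous f x.
Proof. intros H; apply (H 0%nat). Qed.

Lemma smooth_Derive f : smooth f -> smooth (Derive f).
Proof. intros H n; apply (H (S n)). Qed.

Lemma continuity_2d_pt_tensor f g x y :
  continuous f x -> continuous g y ->
  continuity_2d_pt (fun u v => f u * g v) x y.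
Proof.
  intros Hf Hg. apply continuity_2d_pt_filterlim.
  apply (continuous_mult (fun z : R * R => f (fst z)) (fun z => g (snd z)) (x, y)).
  - apply (continuous_comp fst f (x, y)); [apply continuous_fst|exact Hf].
  - apply (continuous_comp snd g (x, y)); [apply continuous_snd|exact Hg].
Qed.

(** Products of functions of one variable are the only test functions used in
    the plane. *)
Lemma ex_diff_n_tensor n :
  forall f g x y, Cn n f -> Cn n g -> ex_diff_n (fun u v => f u * g v) n x y.
Proof.
  induction n as [|n IH]; intros f g x y Hf Hg.
  - split; auto. apply continuity_2d_pt_tensor; [apply Hf|apply Hg].
  - split; [apply continuity_2d_pt_tensor; [apply Hf|apply Hg]|].
    destruct Hf as [Hfc [Hfe Hf]], Hg as [Hgc [Hge Hg]].
    split; [|split; [|split]].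
    + apply (ex_derive_ext (fun z => scal (g y) (f z)));
        [intro t; apply Rmult_comm|apply ex_derive_scal, Hfe].
    + apply ex_derive_scal, Hge.
    + replace (fun u v => Derive (fun z => f z * g v) u)
        with (fun u v => Derive f u * g v).
      * apply IH; auto. apply Cn_S; repeat split; auto.
      * apply functional_extensionality; intro u.
        apply functional_extensionality; intro v. symmetry; apply Derive_scal_l.
    + replace (fun u v => Derive (fun z => f u * g z) v)
        with (fun u v => f u * Derive g v).
      * apply IH; auto. apply Cn_S; repeat split; auto.
      * apply functional_extensionality; intro u.
        apply functional_extensionality; intro v. symmetry; apply Derive_scal.
Qed.

(** The functions [x^(-n) exp(-1/x)], extended by zero, are closed under
    differentiation up to linear combinations; taking the whole family at once
    turns smoothness into an induction on the order of differentiation. *)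
Definition flat (n : nat) (x : R) : R :=
  if Rle_dec x 0 then 0 else exp (- / x) * (/ x) ^ n.

Lemma flat_nonpos n x : x <= 0 -> flat n x = 0.
Proof. intro H; unfold flat; destruct (Rle_dec x 0); [reflexivity|contradiction]. Qed.

Lemma flat_pos_eq n x : 0 < x -> flat n x = exp (- / x) * (/ x) ^ n.
Proof. intro H; unfold flat; destruct (Rle_dec x 0); [lra|reflexivity]. Qed.

(** From [exp (1/x) = (exp (1/(m x)))^m >= (1/(m x))^m] with [m = n + 2]: two
    spare powers of [x] make the difference quotient at 0 vanish. *)
Lemma flat_bound n x :
  Rabs (flat n x) <= INR (n + 2) ^ (n + 2) * x ^ 2.
Proof.
  set (m := (n + 2)%nat).
  assert (Hm : 0 < INR m) by (apply lt_0_INR; unfold m; lia).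
  destruct (Rle_dec x 0) as [Hx|Hx].
  - rewrite flat_nonpos, Rabs_R0 by assumption.
    apply Rmult_le_pos; [apply pow_le; lra|apply pow2_ge_0].
  - apply Rnot_le_lt in Hx. rewrite flat_pos_eq by assumption.
    assert (Hy : 0 < / x) by (apply Rinv_0_lt_compat; assumption).
    assert (H1 : (/ x / INR m) ^ m <= exp (/ x)).
    { replace (exp (/ x)) with (exp (/ x / INR m) ^ m).
      - apply pow_incr; split; [apply Rlt_le, Rdiv_lt_0_compat; assumption|].
        generalize (exp_ineq1_le (/ x / INR m)); lra.
      - rewrite <- Rpower_pow by apply exp_pos.
        unfold Rpower. rewrite ln_exp. f_equal. field. lra. }
    rewrite Rabs_pos_eq by (apply Rmult_le_pos; [apply Rlt_le, exp_pos|apply pow_le; lra]).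
    rewrite exp_Ropp.
    assert (Hmp : 0 < INR m ^ m) by (apply pow_lt; assumption).
    unfold Rdiv in H1. rewrite Rpow_mult_distr, (pow_inv (INR m)) in H1.
    apply (Rmult_le_compat_r (INR m ^ m)) in H1; [|lra].
    replace ((/ x) ^ m * / INR m ^ m * INR m ^ m) with ((/ x) ^ m) in H1 by (field; lra).
    assert (He : 0 < exp (/ x)) by apply exp_pos.
    apply (Rmult_le_reg_l (exp (/ x))); [assumption|].
    replace (exp (/ x) * (/ exp (/ x) * (/ x) ^ n)) with ((/ x) ^ n) by (field; lra).
    replace ((/ x) ^ n) with ((/ x) ^ m * x ^ 2).
    + replace (exp (/ x) * (INR m ^ m * x ^ 2)) with (exp (/ x) * INR m ^ m * x ^ 2) by ring.
      apply Rmult_le_compat_r; [apply pow2_ge_0|exact H1].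
    + unfold m. rewrite pow_add. field. lra.
Qed.

Lemma is_derive_flat n x :
  is_derive (flat n) x (flat (n + 2) x + - INR n * flat (n + 1) x).
Proof.
  destruct (Rtotal_order x 0) as [Hx|[Hx|Hx]].
  - rewrite !flat_nonpos by lra.
    apply (is_derive_ext_loc (fun _ => 0)).
    + exists (mkposreal (- x) ltac:(lra)). intros y Hy.
      rewrite flat_nonpos; [reflexivity|].
      apply Rabs_lt_between' in Hy; simpl in Hy; lra.
    + replace (0 + - INR n * 0) with 0 by ring. apply (is_derive_const 0 x).
  - subst x. rewrite !flat_nonpos by lra. replace (0 + - INR n * 0) with 0 by ring.
    apply is_derive_Reals. intros eps Heps.
    set (C := INR (n + 2) ^ (n + 2)).
    assert (HC : 0 < C) by (apply pow_lt, lt_0_INR; lia).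
    exists (mkposreal (eps / C) ltac:(apply Rdiv_lt_0_compat; assumption)).
    intros h Hh Hlt. simpl in Hlt.
    rewrite Rplus_0_l, (flat_nonpos n 0) by lra.
    replace ((flat n h - 0) / h - 0) with (flat n h / h) by (field; assumption).
    rewrite Rabs_div by assumption.
    assert (Hah : 0 < Rabs h) by (apply Rabs_pos_lt; assumption).
    apply (Rmult_lt_reg_r (Rabs h)); [assumption|].
    replace (Rabs (flat n h) / Rabs h * Rabs h) with (Rabs (flat n h)) by (field; lra).
    eapply Rle_lt_trans; [apply flat_bound|]. fold C.
    rewrite <- (pow2_abs h).
    replace (C * Rabs h ^ 2) with (C * Rabs h * Rabs h) by ring.
    apply Rmult_lt_compat_r; [assumption|].
    apply (Rmult_lt_compat_l C) in Hlt; [|assumption].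
    replace (C * (eps / C)) with eps in Hlt by (field; lra). exact Hlt.
  - rewrite !flat_pos_eq by assumption.
    apply (is_derive_ext_loc (fun y => exp (- / y) * (/ y) ^ n)).
    + exists (mkposreal x Hx). intros y Hy.
      rewrite flat_pos_eq; [reflexivity|].
      apply Rabs_lt_between' in Hy; simpl in Hy; lra.
    + auto_derive; [lra|].
      destruct n as [|n]; [simpl; field; lra|].
      rewrite Nat.pred_succ, S_INR, !pow_add. simpl. field. lra.
Qed.

Lemma smooth_flat n : smooth (flat n).
Proof.
  intro m; revert n; induction m as [|m IH]; intro n.
  - split; auto. intro x. apply (ex_derive_continuous (flat n)). eexists; apply is_derive_flat.
  - apply Cn_is_derive with (1 := is_derive_flat n).
    apply Cn_plus; [apply IH|apply Cn_mult; [apply Cn_const|apply IH]].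
Qed.

Definition bump (x : R) : R := flat 0 (1 * x + 1) * flat 0 (-1 * x + 1).

Lemma smooth_bump : smooth bump.
Proof.
  intro n; apply Cn_mult; apply (Cn_comp_affine n _ _ (flat 0)); apply smooth_flat.
Qed.

Lemma bump_pos x : -1 < x < 1 -> 0 < bump x.
Proof.
  intro H; unfold bump; rewrite !flat_pos_eq by lra.
  simpl; rewrite !Rmult_1_r. apply Rmult_lt_0_compat; apply exp_pos.
Qed.

Lemma bump_out x : x <= -1 \/ 1 <= x -> bump x = 0.
Proof.
  intros [H|H]; unfold bump;
    [rewrite (flat_nonpos 0 (1 * x + 1))|rewrite (flat_nonpos 0 (-1 * x + 1))]; lra.
Qed.

Lemma RInt_bump_pos : 0 < RInt bump (-1) 1.
Proof.
  apply RInt_gt_0; [lra|apply bump_pos|].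
  intros; apply smooth_continuous, smooth_bump.
Qed.

Lemma mollifier_exists e : 0 < e ->
  exists eta : R -> R,
    smooth eta /\ (forall x, 0 <= eta x) /\
    (forall x, x <= - e \/ e <= x -> eta x = 0) /\ RInt eta (- e) e = 1.
Proof.
  intro He. set (c := RInt bump (-1) 1).
  assert (Hc : 0 < c) by apply RInt_bump_pos.
  assert (Hie : 0 < / e) by (apply Rinv_0_lt_compat; assumption).
  exists (fun x => / c * (/ e * bump (/ e * x + 0))). split; [|split; [|split]].
  - intro n. apply Cn_mult; [apply Cn_const|]. apply Cn_mult; [apply Cn_const|].
    apply (Cn_comp_affine n _ _ bump), smooth_bump.
  - intro x.
    apply Rmult_le_pos; [apply Rlt_le, Rinv_0_lt_compat; assumption|].
    apply Rmult_le_pos; [lra|].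
    destruct (Rlt_dec (-1) (/ e * x + 0)) as [H1|H1];
      [destruct (Rlt_dec (/ e * x + 0) 1) as [H2|H2]|].
    + apply Rlt_le, bump_pos; lra.
    + rewrite bump_out; lra.
    + rewrite bump_out; lra.
  - intros x Hx. rewrite bump_out; [ring|].
    assert (Hee : / e * e = 1) by (field; lra).
    destruct Hx as [Hx|Hx]; apply (Rmult_le_compat_l (/ e)) in Hx; lra.
  - assert (Hex : ex_RInt bump (-1) 1)
      by (apply (ex_RInt_continuous bump); intros; apply smooth_continuous, smooth_bump).
    rewrite (RInt_scal (fun x => / e * bump (/ e * x + 0))).
    + transitivity (/ c * RInt bump (/ e * - e + 0) (/ e * e + 0)).
      * apply (f_equal (Rmult (/ c))), (RInt_comp_lin bump (/ e) 0 (- e) e).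
        replace (/ e * - e + 0) with (-1) by (field; lra).
        replace (/ e * e + 0) with 1 by (field; lra). exact Hex.
      * replace (/ e * - e + 0) with (-1) by (field; lra).
        replace (/ e * e + 0) with 1 by (field; lra).
        fold c. apply Rinv_l. lra.
    + apply (ex_RInt_comp_lin bump (/ e) 0 (- e) e).
      replace (/ e * - e + 0) with (-1) by (field; lra).
      replace (/ e * e + 0) with 1 by (field; lra). exact Hex.
Qed.

(** * Continuity and integration lemmas *)

(** [ring] needs the operations of [R] itself, not those of [R] seen as a normed
    module over itself, and integrals as atoms. *)
Ltac Rmodule :=
  unfold minus, plus, opp, zero, one, scal; simpl; unfold mult; simpl;
  match goal with |- @eq _ ?a ?b => change (@eq R a b) end;
  repeat match goal with |- context [@RInt ?V ?f ?a ?b] =>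
    let I := fresh "I" in
    pose (I := @RInt V f a b : R); change (@RInt V f a b) with I; clearbody I
  end.

Lemma continuous_Rplus (f g : R -> R) (x : R) :
  continuous f x -> continuous g x -> continuous (fun t => f t + g t) x.
Proof. apply (continuous_plus f g). Qed.

Lemma continuous_Rminus (f g : R -> R) (x : R) :
  continuous f x -> continuous g x -> continuous (fun t => f t - g t) x.
Proof. apply (continuous_minus f g). Qed.

Lemma continuous_Rmult (f g : R -> R) (x : R) :
  continuous f x -> continuous g x -> continuous (fun t => f t * g t) x.
Proof. apply (continuous_mult f g). Qed.

Lemma continuous_Rcomp (f g : R -> R) (x : R) :
  continuous f x -> continuous g (f x) -> continuous (fun t => g (f t)) x.
Proof. apply (continuous_comp f g). Qed.

Lemma continuous_Rabs_comp (f : R -> R) (x : R) :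
  continuous f x -> continuous (fun t => Rabs (f t)) x.
Proof. intro H. apply (continuous_comp f Rabs); [exact H|apply continuous_Rabs]. Qed.

Lemma ex_RInt_cont (f : R -> R) (a b : R) :
  (forall x, Rmin a b <= x <= Rmax a b -> continuous f x) -> ex_RInt f a b.
Proof. apply (ex_RInt_continuous f). Qed.

Lemma RInt_Rminus (f g : R -> R) (a b : R) :
  ex_RInt f a b -> ex_RInt g a b ->
  RInt (fun y => f y - g y) a b = RInt f a b - RInt g a b.
Proof. apply (RInt_minus f g). Qed.

Lemma RInt_Rplus (f g : R -> R) (a b : R) :
  ex_RInt f a b -> ex_RInt g a b ->
  RInt (fun y => f y + g y) a b = RInt f a b + RInt g a b.
Proof. apply (RInt_plus f g). Qed.

Lemma RInt_Rscal (f : R -> R) (c a b : R) :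
  ex_RInt f a b -> RInt (fun y => c * f y) a b = c * RInt f a b.
Proof. apply (RInt_scal f). Qed.

Lemma ex_RInt_Rminus (f g : R -> R) (a b : R) :
  ex_RInt f a b -> ex_RInt g a b -> ex_RInt (fun y => f y - g y) a b.
Proof. apply (ex_RInt_minus f g). Qed.

Lemma ex_RInt_Rscal (f : R -> R) (c a b : R) :
  ex_RInt f a b -> ex_RInt (fun y => c * f y) a b.
Proof. apply (ex_RInt_scal f). Qed.

Lemma continuity_2d_pt_comp2 (f g h : R -> R -> R) (x y : R) :
  continuity_2d_pt f (g x y) (h x y) ->
  continuity_2d_pt g x y -> continuity_2d_pt h x y ->
  continuity_2d_pt (fun u v => f (g u v) (h u v)) x y.
Proof.
  intros Hf Hg Hh eps. destruct (Hf eps) as [del Hdel].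
  generalize (locally_2d_and _ _ _ _ (Hg del) (Hh del)).
  apply locally_2d_impl, locally_2d_forall. intros u v [H1 H2].
  apply Hdel; assumption.
Qed.

Lemma continuity_2d_pt_fst (f : R -> R) (x y : R) :
  continuous f x -> continuity_2d_pt (fun u _ => f u) x y.
Proof.
  intro Hf. apply continuity_2d_pt_filterlim.
  apply (continuous_comp fst f (x, y)); [apply continuous_fst|exact Hf].
Qed.

Lemma continuity_2d_pt_snd (f : R -> R) (x y : R) :
  continuous f y -> continuity_2d_pt (fun _ v => f v) x y.
Proof.
  intro Hf. apply continuity_2d_pt_filterlim.
  apply (continuous_comp snd f (x, y)); [apply continuous_snd|exact Hf].
Qed.

Lemma continuous_along_curve (f : R -> R -> R) (g h : R -> R) (t : R) :
  continuity_2d_pt f (g t) (h t) -> continuous g t -> continuous h t ->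
  continuous (fun s => f (g s) (h s)) t.
Proof.
  intros Hf Hg Hh.
  apply continuity_2d_pt_filterlim in Hf.
  apply (continuous_comp_2 g h (fun u v => f u v) t Hg Hh).
  exact Hf.
Qed.

Lemma abs_RInt_mult_le (D g : R -> R) (a b del : R) :
  a <= b -> ex_RInt (fun y => D y * g y) a b ->
  (forall y, a <= y <= b -> continuous g y) ->
  (forall y, a <= y <= b -> Rabs (D y) <= del) ->
  Rabs (RInt (fun y => D y * g y) a b) <= del * RInt (fun y => Rabs (g y)) a b.
Proof.
  intros Hab Hex Hg HD.
  assert (Hexg : ex_RInt (fun y => Rabs (g y)) a b).
  { apply ex_RInt_cont. intros x Hx. rewrite Rmin_left, Rmax_right in Hx by assumption.
    apply continuous_Rabs_comp, Hg, Hx. }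
  rewrite <- (RInt_Rscal (fun y => Rabs (g y)) del a b Hexg).
  eapply Rle_trans; [apply (abs_RInt_le _ a b Hab Hex)|].
  apply RInt_le; [exact Hab| | |].
  - apply (ex_RInt_norm (fun y => D y * g y) a b Hex).
  - apply (ex_RInt_Rscal (fun y => Rabs (g y)) del a b Hexg).
  - intros x Hx. rewrite Rabs_mult. apply Rmult_le_compat_r; [apply Rabs_pos|].
    apply HD; lra.
Qed.

Definition jointly_continuous (f : R -> R -> R) : Prop :=
  forall x y, continuity_2d_pt f x y.

(** * Mollification in the second variable *)

(** Convolution in [u], for kernels supported in [[-e, e]]; [r] is a parameter. *)
Definition conv (e : R) (chi : R -> R -> R) (g : R -> R) (r v : R) : R :=
  RInt (fun y => chi r (v - y) * g y) (- e) e.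

Lemma continuous_section (f : R -> R -> R) (r v : R) :
  jointly_continuous f -> continuous (f r) v.
Proof.
  intro Hf. apply (continuous_along_curve f (fun _ => r) (fun t => t));
    [apply Hf|apply continuous_const|apply continuous_id].
Qed.

Lemma continuous_reflect (f : R -> R) (v y : R) :
  continuous f (v - y) -> continuous (fun t => f (v - t)) y.
Proof.
  intro Hf. apply (continuous_Rcomp (fun t => v - t) f); [|exact Hf].
  apply continuous_Rminus; [apply continuous_const|apply continuous_id].
Qed.

Lemma ex_RInt_conv e chi g r v :
  jointly_continuous chi -> (forall x, continuous g x) ->
  ex_RInt (fun y => chi r (v - y) * g y) (- e) e.
Proof.
  intros Hchi Hg. apply ex_RInt_cont. intros y _.
  apply continuous_Rmult; [|apply Hg].
  apply (continuous_reflect (chi r)), continuous_section, Hchi.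
Qed.

Lemma RInt_reflect (F : R -> R) (v a b : R) :
  ex_RInt F (v - b) (v - a) ->
  RInt (fun y => F (v - y)) a b = RInt F (v - b) (v - a).
Proof.
  intro Hex. apply is_RInt_unique.
  set (l := RInt F (v - b) (v - a)).
  assert (Hl : is_RInt F (v - b) (v - a) l) by apply (RInt_correct F _ _ Hex).
  apply is_RInt_swap in Hl.
  assert (H := is_RInt_comp_lin F (-1) v a b (opp l)).
  replace (-1 * a + v) with (v - a) in H by ring.
  replace (-1 * b + v) with (v - b) in H by ring.
  specialize (H Hl). apply is_RInt_opp in H. rewrite opp_opp in H.
  eapply is_RInt_ext; [|exact H].
  intros y _. Rmodule.
  replace (-1 * y + v) with (v - y) by ring. ring.
Qed.

(** With the kernel carrying [v], the domain of integration no longer depends on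
    [v]: this is the form that can be differentiated under the integral, and
    the form in which the kernel is a test function of [u]. *)
Lemma conv_as_fixed_integral e chi g r v a b :
  0 < e -> jointly_continuous chi -> (forall x, continuous g x) ->
  (forall x, x <= - e \/ e <= x -> g x = 0) ->
  a <= v - e -> v + e <= b ->
  conv e chi g r v = RInt (fun u => chi r u * g (v - u)) a b.
Proof.
  intros He Hchi Hg Hsupp Ha Hb.
  set (F := fun u => chi r u * g (v - u)).
  assert (HF : forall x, continuous F x).
  { intro x. apply continuous_Rmult; [apply continuous_section, Hchi|].
    apply (continuous_reflect g), Hg. }
  assert (Hex : forall c c', ex_RInt F c c') by (intros; apply ex_RInt_cont; auto).
  rewrite <- (RInt_Chasles F a (v - e) b), <- (RInt_Chasles F (v - e) (v + e) b) by auto.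
  rewrite (RInt_ext F (fun _ => 0) a), (RInt_ext F (fun _ => 0) (v + e)).
  - rewrite !RInt_const. unfold conv.
    rewrite (RInt_ext _ (fun y => F (v - y))).
    + rewrite RInt_reflect by auto. replace (v - - e) with (v + e) by ring.
      Rmodule; ring.
    + intros y _. unfold F. replace (v - (v - y)) with y by ring. reflexivity.
  - intros x Hx. rewrite Rmin_left, Rmax_right in Hx by lra.
    unfold F; rewrite Hsupp; lra.
  - intros x Hx. rewrite Rmin_left, Rmax_right in Hx by lra.
    unfold F; rewrite Hsupp; lra.
Qed.

Lemma smooth_support_Derive e g :
  smooth g -> (forall x, x <= - e \/ e <= x -> g x = 0) ->
  forall x, x <= - e \/ e <= x -> Derive g x = 0.
Proof.
  intros Hg Hs.
  assert (Hopen : forall x, x < - e \/ e < x -> Derive g x = 0).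
  { intros x Hx. transitivity (Derive (fun _ => 0) x); [|apply Derive_const].
    apply Derive_ext_loc. destruct Hx as [Hx|Hx].
    - exists (mkposreal (- e - x) ltac:(lra)). intros y Hy.
      apply Hs. apply Rabs_lt_between' in Hy; simpl in Hy; lra.
    - exists (mkposreal (x - e) ltac:(lra)). intros y Hy.
      apply Hs. apply Rabs_lt_between' in Hy; simpl in Hy; lra. }
  assert (Hc : forall x, continuous (Derive g) x)
    by (intro; apply smooth_continuous, smooth_Derive, Hg).
  (* at the edge of the support the value is a limit of zeros from outside *)
  assert (Hedge : forall x s, Rabs s = 1 ->
             (forall t, 0 < t -> Derive g (x + s * t) = 0) -> Derive g x = 0).
  { intros x s Hs1 Ht.
    destruct (Req_dec (Derive g x) 0) as [|Hne]; [assumption|exfalso].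
    assert (Hp : 0 < Rabs (Derive g x)) by (apply Rabs_pos_lt; assumption).
    destruct (proj1 (filterlim_locally _ _) (Hc x) (mkposreal _ Hp)) as [del Hdel].
    assert (Hdp := cond_pos del).
    specialize (Hdel (x + s * (del / 2))). rewrite Ht in Hdel by lra.
    assert (Rabs (0 - Derive g x) < Rabs (Derive g x)).
    { apply Hdel. change (Rabs (x + s * (del / 2) - x) < del).
      replace (x + s * (del / 2) - x) with (s * (del / 2)) by ring.
      rewrite Rabs_mult, Hs1, Rabs_pos_eq by lra. lra. }
    rewrite Rminus_0_l, Rabs_Ropp in H. lra. }
  intros x [Hx|Hx].
  - apply (Hedge x (-1)); [rewrite Rabs_left; lra|].
    intros t Ht; apply Hopen; lra.
  - apply (Hedge x 1); [apply Rabs_R1|]. intros t Ht; apply Hopen; lra.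
Qed.

Lemma is_derive_conv e chi g r v :
  0 < e -> jointly_continuous chi -> smooth g ->
  (forall x, x <= - e \/ e <= x -> g x = 0) ->
  is_derive (conv e chi g r) v (conv e chi (Derive g) r v).
Proof.
  intros He Hchi Hg Hs.
  assert (Hgc : forall x, continuous g x) by (intro; apply smooth_continuous, Hg).
  assert (Hgc' : forall x, continuous (Derive g) x)
    by (intro; apply smooth_continuous, smooth_Derive, Hg).
  set (a := v - e - 1). set (b := v + e + 1).
  assert (HD : forall z u,
             is_derive (fun w => chi r u * g (w - u)) z (chi r u * Derive g (z - u))).
  { intros z u. auto_derive; [apply smooth_ex_derive, Hg|].
    rewrite Rmult_1_l. reflexivity. }
  rewrite (conv_as_fixed_integral e chi (Derive g) r v a b);
    auto; [|apply smooth_support_Derive; assumption|unfold a; lra|unfold b; lra].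
  apply (is_derive_ext_loc (fun w => RInt (fun u => chi r u * g (w - u)) a b)).
  { exists (mkposreal 1 Rlt_0_1). intros w Hw.
    apply Rabs_lt_between' in Hw; simpl in Hw. symmetry.
    apply conv_as_fixed_integral; auto; unfold a, b; lra. }
  rewrite (RInt_ext _ (fun u => Derive (fun w => chi r u * g (w - u)) v)).
  - apply is_derive_RInt_param.
    + apply filter_forall. intros z u _. eexists; apply HD.
    + intros u _.
      apply (continuity_2d_pt_ext (fun z u => chi r u * Derive g (z - u))).
      { intros z t. symmetry. apply is_derive_unique, HD. }
      apply continuity_2d_pt_mult.
      * apply continuity_2d_pt_snd, continuous_section, Hchi.
      * apply (continuity_2d_pt_comp2 (fun s _ => Derive g s) (fun z t => z - t)
                 (fun _ t => t)).
        -- apply continuity_2d_pt_fst, Hgc'.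
        -- apply continuity_2d_pt_minus;
             [apply continuity_2d_pt_id1|apply continuity_2d_pt_id2].
        -- apply continuity_2d_pt_id2.
    + apply filter_forall. intro z. apply ex_RInt_cont. intros u _.
      apply continuous_Rmult; [apply continuous_section, Hchi|].
      apply (continuous_reflect g), Hgc.
  - intros u _. symmetry. apply is_derive_unique, HD.
Qed.

Lemma jointly_continuous_conv e chi g :
  0 < e -> jointly_continuous chi -> (forall x, continuous g x) ->
  jointly_continuous (conv e chi g).
Proof.
  intros He Hchi Hg r v eps.
  set (N := RInt (fun y => Rabs (g y)) (- e) e).
  assert (HN : 0 <= N).
  { apply RInt_ge_0; [lra| |intros; apply Rabs_pos].
    apply ex_RInt_cont. intros; apply continuous_Rabs_comp, Hg. }
  assert (Hep : 0 < eps / (N + 1)) by (apply Rdiv_lt_0_compat; [apply cond_pos|lra]).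
  destruct (uniform_continuity_2d chi (r - 1) (r + 1) (v - e - 1) (v + e + 1)
              (fun x y _ _ => Hchi x y) (mkposreal _ Hep)) as [del Hdel].
  simpl in Hdel. assert (Hdp := cond_pos del).
  assert (Hm : 0 < Rmin 1 del) by (apply Rmin_glb_lt; lra).
  exists (mkposreal _ Hm). simpl. intros r' v' Hr Hv.
  assert (Hr1 := Rlt_le_trans _ _ _ Hr (Rmin_l _ _)).
  assert (Hr2 := Rlt_le_trans _ _ _ Hr (Rmin_r _ _)).
  assert (Hv1 := Rlt_le_trans _ _ _ Hv (Rmin_l _ _)).
  assert (Hv2 := Rlt_le_trans _ _ _ Hv (Rmin_r _ _)).
  apply Rabs_lt_between' in Hr1. apply Rabs_lt_between' in Hv1.
  unfold conv.
  assert (E1 := ex_RInt_conv e chi g r' v' Hchi Hg).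
  assert (E2 := ex_RInt_conv e chi g r v Hchi Hg).
  rewrite <- (RInt_Rminus _ _ _ _ E1 E2).
  rewrite (RInt_ext _ (fun y => (chi r' (v' - y) - chi r (v - y)) * g y))
    by (intros; Rmodule; ring).
  apply Rle_lt_trans with (eps / (N + 1) * N).
  - apply abs_RInt_mult_le; [lra| |intros; apply Hg|].
    + eapply ex_RInt_ext; [|exact (ex_RInt_Rminus _ _ _ _ E1 E2)].
      intros; Rmodule; ring.
    + intros y Hy. apply Rlt_le, Hdel; try lra.
      replace (v' - y - (v - y)) with (v' - v) by ring. assumption.
  - assert (0 < eps) by apply cond_pos.
    apply (Rmult_lt_reg_r (N + 1)); [lra|].
    replace (eps / (N + 1) * N * (N + 1)) with (eps * N) by (field; lra).
    apply Rmult_lt_compat_l; lra.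
Qed.

Lemma conv_mollifier_close e chi eta r v del :
  0 < e -> jointly_continuous chi -> (forall x, continuous eta x) ->
  (forall x, 0 <= eta x) -> RInt eta (- e) e = 1 ->
  (forall u, Rabs (u - v) <= e -> Rabs (chi r u - chi r v) <= del) ->
  Rabs (conv e chi eta r v - chi r v) <= del.
Proof.
  intros He Hchi Hc Hp H1 Hdel.
  assert (E1 := ex_RInt_conv e chi eta r v Hchi Hc).
  assert (E0 : ex_RInt eta (- e) e) by (apply ex_RInt_cont; intros; apply Hc).
  assert (E2 := ex_RInt_Rscal eta (chi r v) (- e) e E0).
  replace (chi r v) with (chi r v * 1) at 1 by ring. rewrite <- H1.
  unfold conv. rewrite <- (RInt_Rscal eta (chi r v) (- e) e E0).
  rewrite <- (RInt_Rminus _ _ _ _ E1 E2).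
  rewrite (RInt_ext _ (fun y => (chi r (v - y) - chi r v) * eta y))
    by (intros; Rmodule; ring).
  replace del with (del * RInt (fun y => Rabs (eta y)) (- e) e).
  - apply abs_RInt_mult_le; [lra| |intros; apply Hc|].
    + eapply ex_RInt_ext; [|exact (ex_RInt_Rminus _ _ _ _ E1 E2)].
      intros; Rmodule; ring.
    + intros y Hy. apply Hdel. apply Rabs_le. lra.
  - rewrite (RInt_ext _ eta) by (intros; apply Rabs_pos_eq, Hp).
    rewrite H1. ring.
Qed.

(** * Second derivatives in the sense of distributions *)

Lemma is_derive_Rmult (f g : R -> R) (x a b : R) :
  is_derive f x a -> is_derive g x b ->
  is_derive (fun t => f t * g t) x (a * g x + f x * b).
Proof. intros Hf Hg. apply (is_derive_mult f g x a b Hf Hg), Rmult_comm. Qed.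

Lemma is_derive_Rplus (f g : R -> R) (x a b : R) :
  is_derive f x a -> is_derive g x b -> is_derive (fun t => f t + g t) x (a + b).
Proof. apply (is_derive_plus f g). Qed.

Lemma is_derive_Rminus (f g : R -> R) (x a b : R) :
  is_derive f x a -> is_derive g x b -> is_derive (fun t => f t - g t) x (a - b).
Proof. apply (is_derive_minus f g). Qed.

Lemma is_derive_eq (f : R -> R) (x a b : R) : is_derive f x a -> a = b -> is_derive f x b.
Proof. intros H <-; exact H. Qed.

Lemma is_derive_RInt_continuous (G : R -> R) (A x : R) :
  (forall y, continuous G y) -> is_derive (fun t => RInt G A t) x (G x).
Proof.
  intro HG. apply (is_derive_RInt G (fun t => RInt G A t) A).
  - apply filter_forall. intro t. apply (RInt_correct G).
    apply ex_RInt_cont; intros; apply HG.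
  - apply HG.
Qed.

Lemma continuous_local_bound (f : R -> R) (x del : R) :
  continuous f x -> 0 < del ->
  exists e, 0 < e /\ forall u, Rabs (u - x) < e -> Rabs (f u - f x) < del.
Proof.
  intros Hf Hd.
  destruct (proj1 (filterlim_locally _ _) Hf (mkposreal _ Hd)) as [e He].
  exists e. split; [apply cond_pos|]. exact He.
Qed.

Lemma Rabs_le_all_eps (x K : R) :
  0 <= K -> (forall del, 0 < del -> Rabs x <= del * K) -> x = 0.
Proof.
  intros HK H. destruct (Req_dec x 0) as [|Hx]; [assumption|exfalso].
  assert (Hp : 0 < Rabs x) by (apply Rabs_pos_lt; assumption).
  specialize (H (Rabs x / (2 * (K + 1)))).
  assert (Hd : 0 < Rabs x / (2 * (K + 1))) by (apply Rdiv_lt_0_compat; lra).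
  specialize (H Hd).
  assert (E : Rabs x / (2 * (K + 1)) * K = Rabs x / 2 - Rabs x / (2 * (K + 1)))
    by (field; lra).
  lra.
Qed.

Lemma smooth_reflect phi x : smooth phi -> smooth (fun s => phi (x - s)).
Proof.
  intros H n.
  replace (fun s => phi (x - s)) with (fun s => phi (-1 * s + x)).
  - apply Cn_comp_affine, H.
  - apply functional_extensionality; intro s. f_equal; ring.
Qed.

Lemma is_derive_reflect (phi : R -> R) x s :
  smooth phi -> is_derive (fun s : R => phi (x - s)) s (- Derive phi (x - s)).
Proof.
  intro H. auto_derive; [apply smooth_ex_derive, H|].
  change (Derive (fun t => phi t)) with (Derive phi). unfold Rminus. ring.
Qed.

Lemma Derive2_reflect phi x s :
  smooth phi -> Derive (Derive (fun s => phi (x - s))) s = Derive (Derive phi) (x - s).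
Proof.
  intro H. rewrite (Derive_ext _ (fun s => - Derive phi (x - s))).
  - rewrite Derive_opp.
    rewrite <- (Ropp_involutive (Derive (Derive phi) (x - s))).
    apply (f_equal Ropp), is_derive_unique, is_derive_reflect, smooth_Derive, H.
  - intro t. apply is_derive_unique, is_derive_reflect, H.
Qed.

(** Integration by parts twice, through the primitive [phi' H - phi H']. *)
Lemma ibp_twice (phi H H1 H2 : R -> R) (a b : R) :
  smooth phi -> (forall x, is_derive H x (H1 x)) -> (forall x, is_derive H1 x (H2 x)) ->
  (forall x, continuous H2 x) ->
  phi a = 0 -> phi b = 0 -> Derive phi a = 0 -> Derive phi b = 0 ->
  is_RInt (fun s => Derive (Derive phi) s * H s - phi s * H2 s) a b 0.
Proof.
  intros Hphi HH HH1 HH2 Ea Eb Ea' Eb'.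
  assert (Hphi1 := smooth_Derive _ Hphi). assert (Hphi2 := smooth_Derive _ Hphi1).
  assert (Hc : forall x, continuous H x)
    by (intro x; apply (ex_derive_continuous H); eexists; apply HH).
  assert (D : is_RInt (fun s => Derive (Derive phi) s * H s - phi s * H2 s) a b
    (minus (Derive phi b * H b - phi b * H1 b) (Derive phi a * H a - phi a * H1 a))).
  { apply (is_RInt_derive (fun s => Derive phi s * H s - phi s * H1 s)).
    - intros x _.
      eapply is_derive_eq.
      + apply is_derive_Rminus; apply is_derive_Rmult;
          [apply Derive_correct, smooth_ex_derive; assumption|apply HH
          |apply Derive_correct, smooth_ex_derive; assumption|apply HH1].
      + ring.
    - intros x _. apply continuous_Rminus; apply continuous_Rmult; auto;
        apply smooth_continuous; assumption. }
  rewrite Ea, Eb, Ea', Eb' in D.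
  replace (minus (0 * H b - 0 * H1 b) (0 * H a - 0 * H1 a)) with 0 in D
    by (Rmodule; ring).
  exact D.
Qed.

Lemma affine_of_zero_second_derivative (g g1 g2 : R -> R) (A B : R) :
  A < B -> (forall x, is_derive g x (g1 x)) -> (forall x, is_derive g1 x (g2 x)) ->
  (forall x, A <= x <= B -> g2 x = 0) ->
  forall x, A <= x <= B -> g x * (B - A) = g A * (B - x) + g B * (x - A).
Proof.
  intros HAB Hg Hg1 Hz.
  assert (Hconst : forall x, A <= x <= B -> g1 x = g1 A).
  { intros x Hx. destruct (Req_dec A x) as [->|Hne]; [reflexivity|].
    symmetry. apply (eq_is_derive g1); [|lra].
    intros t Ht. apply (is_derive_eq _ _ _ _ (Hg1 t)), Hz. lra. }
  assert (Hlin : forall x, A <= x <= B -> g x = g A + g1 A * (x - A)).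
  { intros x Hx. destruct (Req_dec A x) as [->|Hne]; [ring|].
    assert (E : g A - g1 A * A = g x - g1 A * x); [|lra].
    apply (eq_is_derive (fun t => g t - g1 A * t)); [|lra].
    intros t Ht. eapply is_derive_eq.
    - apply is_derive_Rminus; [apply Hg|].
      apply (is_derive_scal (fun t => t) t (g1 A) 1), (is_derive_id t).
    - rewrite Hconst by lra. Rmodule; ring. }
  intros x Hx. rewrite (Hlin x Hx), (Hlin B) by lra. ring.
Qed.

(** If [F'' = G] in the sense of distributions and [G] is continuous, then [F]
    differs from the second primitive [H] of [G] by an affine function. Indeed
    [W = F - H] has zero second derivative as a distribution, so its mollified
    functions are affine, and so is their limit [W]. The conclusion expresses the
    affine function by its values at [A] and [B]: with a parameter in [F] and
    [G], its dependence on the parameter is then explicit. *)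
Lemma second_derivative_of_distributional (F G : R -> R) (a0 A B b0 : R) :
  a0 < A < B -> B < b0 ->
  (forall x, continuous F x) -> (forall x, continuous G x) ->
  (forall phi, smooth phi -> (forall x, phi x <> 0 -> a0 <= x <= b0) ->
     RInt (fun s => Derive (Derive phi) s * F s - phi s * G s) a0 b0 = 0) ->
  let H := fun x => RInt (fun t => RInt G A t) A x in
  forall x, A <= x <= B ->
    F x = H x + F A * ((B - x) / (B - A)) + (F B - H B) * ((x - A) / (B - A)).
Proof.
  intros HA HB HF HG Hweak H x Hx.
  assert (HH1 : forall y, is_derive (fun t => RInt G A t) y (G y))
    by (intro; apply is_derive_RInt_continuous, HG).
  assert (HH : forall y, is_derive H y (RInt G A y)).
  { intro y. apply (is_derive_RInt_continuous (fun t => RInt G A t)).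
    intro t. apply (ex_derive_continuous (fun t => RInt G A t)). eexists; apply HH1. }
  assert (HHc : forall y, continuous H y)
    by (intro y; apply (ex_derive_continuous H); eexists; apply HH).
  set (W := fun t => F t - H t).
  assert (HW : forall y, continuous W y) by (intro; apply continuous_Rminus; auto).
  assert (HWj : jointly_continuous (fun _ => W))
    by (intros r v; apply continuity_2d_pt_snd, HW).
  assert (Haff : W x * (B - A) - (W A * (B - x) + W B * (x - A)) = 0).
  { apply (Rabs_le_all_eps _ (2 * (B - A))); [lra|]. intros del Hdel.
    destruct (continuous_local_bound W x del (HW x) Hdel) as [e1 [He1 Hb1]].
    destruct (continuous_local_bound W A del (HW A) Hdel) as [e2 [He2 Hb2]].
    destruct (continuous_local_bound W B del (HW B) Hdel) as [e3 [He3 Hb3]].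
    set (e := Rmin (Rmin e1 e2) (Rmin e3 (Rmin (A - a0) (b0 - B))) / 2).
    assert (He : 0 < e) by (unfold e; repeat (unfold Rmin; destruct (Rle_dec _ _)); lra).
    assert (Hes : e < e1 /\ e < e2 /\ e < e3 /\ e < A - a0 /\ e < b0 - B)
      by (unfold e; repeat (unfold Rmin; destruct (Rle_dec _ _)); lra).
    clearbody e. destruct Hes as [Hs1 [Hs2 [Hs3 [Hs4 Hs5]]]].
    destruct (mollifier_exists e He) as [eta [Hsm [Hpos [Hsup Hint]]]].
    assert (Hsm1 := smooth_Derive _ Hsm). assert (Hsm2 := smooth_Derive _ Hsm1).
    assert (Hsup1 := smooth_support_Derive e eta Hsm Hsup).
    assert (Hsup2 := smooth_support_Derive e _ Hsm1 Hsup1).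
    assert (Hetac : forall y, continuous eta y) by (intro; apply smooth_continuous, Hsm).
    assert (Hzero : forall z, A <= z <= B ->
      conv e (fun _ => W) (Derive (Derive eta)) 0 z = 0).
    { intros z Hz.
      rewrite (conv_as_fixed_integral e (fun _ => W) _ 0 z a0 b0); auto; try lra;
        [|intro; apply smooth_continuous, Hsm2].
      set (phi := fun s => eta (z - s)).
      assert (Hphi : smooth phi) by apply smooth_reflect, Hsm.
      assert (Hphi1 := smooth_Derive _ Hphi). assert (Hphi2 := smooth_Derive _ Hphi1).
      assert (Hd1 : forall s, Derive phi s = - Derive eta (z - s))
        by (intro; apply is_derive_unique, is_derive_reflect, Hsm).
      rewrite (RInt_ext _ (fun s => (Derive (Derive phi) s * F s - phi s * G s)
                              - (Derive (Derive phi) s * H s - phi s * G s))).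
      - assert (Hi := ibp_twice phi H _ G a0 b0 Hphi HH HH1 HG).
        rewrite RInt_Rminus.
        + rewrite Hweak; [|exact Hphi|].
          * rewrite (is_RInt_unique _ _ _ 0); [apply Rminus_0_r|]. apply Hi.
            -- apply Hsup; lra.
            -- apply Hsup; lra.
            -- rewrite Hd1, Hsup1; lra.
            -- rewrite Hd1, Hsup1; lra.
          * intros s Hs. destruct (Rle_dec a0 s) as [|n1]; [destruct (Rle_dec s b0) as [|n2]|].
            -- lra.
            -- elim Hs; apply Hsup; lra.
            -- elim Hs; apply Hsup; lra.
        + apply ex_RInt_cont; intros s _; apply continuous_Rminus; apply continuous_Rmult;
            auto; apply smooth_continuous; assumption.
        + apply ex_RInt_cont; intros s _; apply continuous_Rminus; apply continuous_Rmult;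
            auto; apply smooth_continuous; assumption.
      - intros s _. unfold phi at 1. rewrite (Derive2_reflect eta z s Hsm).
        unfold phi. rewrite (Derive2_reflect eta z s Hsm). unfold W. Rmodule; ring. }
    assert (Hline := affine_of_zero_second_derivative
      (conv e (fun _ => W) eta 0) _ _ A B (proj2 HA)
      (fun v => is_derive_conv e (fun _ => W) eta 0 v He HWj Hsm Hsup)
      (fun v => is_derive_conv e (fun _ => W) _ 0 v He HWj Hsm1 Hsup1)
      Hzero x Hx).
    assert (Hclose : forall y ey, e < ey ->
      (forall u, Rabs (u - y) < ey -> Rabs (W u - W y) < del) ->
      Rabs (conv e (fun _ => W) eta 0 y - W y) <= del).
    { intros y ey Hey Hby.
      apply (conv_mollifier_close e (fun _ => W)); auto.
      intros u Hu. apply Rlt_le, Hby. lra. }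
    assert (C1 := Hclose x e1 Hs1 Hb1). assert (C2 := Hclose A e2 Hs2 Hb2).
    assert (C3 := Hclose B e3 Hs3 Hb3).
    apply Rabs_le_between in C1. apply Rabs_le_between in C2. apply Rabs_le_between in C3.
    set (cx := conv e (fun _ => W) eta 0 x) in *.
    set (cA := conv e (fun _ => W) eta 0 A) in *.
    set (cB := conv e (fun _ => W) eta 0 B) in *.
    replace (W x * (B - A) - (W A * (B - x) + W B * (x - A)))
      with ((cA - W A) * (B - x) + (cB - W B) * (x - A) - (cx - W x) * (B - A))
      by (ring_simplify; lra).
    apply Rabs_le. split; nra. }
  assert (HA0 : H A = 0) by apply (RInt_point A (fun t => RInt G A t)).
  unfold W in Haff. rewrite HA0 in Haff.
  assert (Hne : B - A <> 0) by lra.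
  apply (Rmult_eq_reg_r (B - A)); [|exact Hne].
  replace ((H x + F A * ((B - x) / (B - A)) + (F B - H B) * ((x - A) / (B - A))) * (B - A))
    with (H x * (B - A) + F A * (B - x) + (F B - H B) * (x - A)) by (field; exact Hne).
  lra.
Qed.

(** * Regularity of [k] *)

Lemma locally_pos (x : R) : 0 < x -> locally x (fun y => 0 < y).
Proof.
  intro Hx. exists (mkposreal x Hx). intros y Hy.
  apply Rabs_lt_between' in Hy; simpl in Hy; lra.
Qed.

(** For a nonnegative integrand, [x |-> RInt f x c] increases as [x] decreases to
    0, so the improper integral is its supremum. *)
Lemma ex_RInt_gen_at_right (f : R -> R) (c K : R) :
  0 < c -> (forall y, 0 < y -> continuous f y) -> (forall y, 0 < y -> 0 <= f y) ->
  (forall x, 0 < x <= c -> RInt f x c <= K) ->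
  exists l, is_RInt_gen f (at_right 0) (at_point c) l.
Proof.
  intros Hc Hf Hpos HK.
  assert (Hex : forall x y, 0 < x -> 0 < y -> ex_RInt f x y).
  { intros x y Hx Hy. apply ex_RInt_cont. intros z Hz. apply Hf.
    apply Rlt_le_trans with (Rmin x y); [apply Rmin_glb_lt; assumption|apply Hz]. }
  destruct (completeness (fun I => exists x, 0 < x <= c /\ I = RInt f x c)) as [l [Hub Hlub]].
  - exists K. intros I [x [Hx ->]]. apply HK, Hx.
  - exists (RInt f c c), c. split; [lra|reflexivity].
  - exists l. apply filterlimi_locally. intro eps. assert (Heps := cond_pos eps).
    assert (Hnear : exists x0, 0 < x0 <= c /\ l - eps < RInt f x0 c).
    { destruct (classic (exists x0, 0 < x0 <= c /\ l - eps < RInt f x0 c))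
        as [|Hno]; [assumption|exfalso].
      assert (l <= l - eps); [|lra]. apply Hlub. intros I [x [Hx ->]].
      apply Rnot_lt_le. intro Hlt. apply Hno. exists x; split; assumption. }
    destruct Hnear as [x0 [Hx0 Hl0]].
    apply (Filter_prod _ _ _ (fun x => 0 < x < x0) (fun y => y = c)).
    + exists (mkposreal x0 (proj1 Hx0)). intros y Hy Hy0.
      apply Rabs_lt_between' in Hy; simpl in Hy; lra.
    + reflexivity.
    + intros x y Hx ->. exists (RInt f x c). split; [apply (RInt_correct f), Hex; lra|].
      assert (Hle : RInt f x c <= l) by (apply Hub; exists x; split; [lra|reflexivity]).
      assert (Hge : RInt f x0 c <= RInt f x c).
      { rewrite <- (RInt_Chasles f x x0 c) by (apply Hex; lra).
        assert (0 <= RInt f x x0).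
        { apply RInt_ge_0; [lra|apply Hex; lra|]. intros z Hz; apply Hpos; lra. }
        unfold plus; simpl. lra. }
      change (Rabs (RInt f x c - l) < eps). apply Rabs_lt_between. lra.
Qed.

Definition speed (p : R -> R) (y : R) : R := sqrt (Derive p y) / y.

Lemma Ck_pos_ex_derive n f j x :
  Ck_pos n f -> (S j <= n)%nat -> 0 < x -> ex_derive (Derive_n f j) x.
Proof. intros H Hj Hx. exact (proj1 (H (S j) x Hj Hx)). Qed.

Definition speed' (p : R -> R) (y : R) : R :=
  (Derive_n p 2 y * / (2 * sqrt (Derive p y)) * y - sqrt (Derive p y)) * (/ y * / y).

Lemma is_derive_speed (p : R -> R) (Hk4 : Ck_pos 4 p)
    (Hp1 : forall y, 0 < y -> 0 < Derive p y) y : 0 < y -> is_derive (speed p) y (speed' p y).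
Proof.
  intro Hy. assert (Hs := sqrt_lt_R0 _ (Hp1 y Hy)).
  assert (D1 : is_derive (Derive p) y (Derive_n p 2 y)).
  { apply (Derive_correct (Derive p)), (Ck_pos_ex_derive 4 p 1); auto. }
  assert (D2 := is_derive_sqrt _ _ _ D1 (Hp1 y Hy)).
  assert (D3 : is_derive (fun t : R => / t) y (- (1) / y ^ 2)).
  { auto_derive; [lra|]. field; lra. }
  eapply is_derive_eq; [apply (is_derive_Rmult _ _ _ _ _ D2 D3)|].
  unfold speed'. field. split; lra.
Qed.

Lemma continuous_Derive_p (p : R -> R) (Hk4 : Ck_pos 4 p) y : 0 < y -> continuous (Derive p) y.
Proof. intro Hy. apply (Hk4 1%nat y); auto; lia. Qed.

Lemma continuous_sqrt_Derive_p (p : R -> R) (Hk4 : Ck_pos 4 p) y :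
  0 < y -> continuous (fun t => sqrt (Derive p t)) y.
Proof.
  intro Hy. apply (continuous_Rcomp (Derive p) sqrt); [apply continuous_Derive_p; assumption|].
  apply continuous_sqrt.
Qed.

Lemma continuous_Rinv_pos (f : R -> R) y :
  continuous f y -> 0 < f y -> continuous (fun t => / f t) y.
Proof.
  intros Hf Hp. apply (continuous_Rcomp f Rinv); [exact Hf|].
  apply (ex_derive_continuous Rinv). auto_derive. lra.
Qed.

Lemma continuous_speed (p : R -> R) (Hk4 : Ck_pos 4 p)
    (Hp1 : forall y, 0 < y -> 0 < Derive p y) y : 0 < y -> continuous (speed p) y.
Proof.
  intro Hy. apply (ex_derive_continuous (speed p)). eexists; apply is_derive_speed; assumption.
Qed.

Lemma continuous_speed' (p : R -> R) (Hk4 : Ck_pos 4 p)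
    (Hp1 : forall y, 0 < y -> 0 < Derive p y) y : 0 < y -> continuous (speed' p) y.
Proof.
  intro Hy. assert (Hs := sqrt_lt_R0 _ (Hp1 y Hy)).
  assert (Hi : continuous (fun t : R => / t) y)
    by (apply (continuous_Rinv_pos (fun t => t)); [apply continuous_id|exact Hy]).
  apply continuous_Rmult; [|apply continuous_Rmult; exact Hi].
  apply continuous_Rminus; [|apply continuous_sqrt_Derive_p; assumption].
  apply continuous_Rmult; [|apply continuous_id].
  apply continuous_Rmult; [apply (Hk4 2%nat y); auto; lia|].
  apply continuous_Rinv_pos; [|lra].
  apply continuous_Rmult; [apply continuous_const|apply continuous_sqrt_Derive_p; assumption].
Qed.

(** [k] is [l + RInt (speed p) c], by additivity of the improper integral. *)
Lemma is_derive_k (p : R -> R) (Hk4 : Ck_pos 4 p)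
    (Hp1 : forall y, 0 < y -> 0 < Derive p y) (c l : R) :
  0 < c -> is_RInt_gen (speed p) (at_right 0) (at_point c) l ->
  forall y, 0 < y -> is_derive (k p) y (speed p y).
Proof.
  intros Hc Hl y Hy.
  assert (Hex : forall z, 0 < z -> is_RInt (speed p) c z (RInt (speed p) c z)).
  { intros z Hz. apply (RInt_correct (speed p)), ex_RInt_cont. intros t Ht.
    apply continuous_speed; [exact Hk4|exact Hp1|].
    apply Rlt_le_trans with (Rmin c z); [apply Rmin_glb_lt; assumption|apply Ht]. }
  assert (Hk : forall z, 0 < z -> l + RInt (speed p) c z = k p z).
  { intros z Hz. symmetry. unfold k. fold (speed p).
    apply is_RInt_gen_unique.
    apply (is_RInt_gen_Chasles (speed p) c l (RInt (speed p) c z) Hl).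
    apply is_RInt_gen_at_point, Hex, Hz. }
  apply (is_derive_ext_loc (fun z => l + RInt (speed p) c z)).
  - generalize (locally_pos y Hy). apply filter_imp. exact Hk.
  - eapply is_derive_eq; [apply is_derive_Rplus|].
    + apply (is_derive_const l).
    + apply (is_derive_RInt (speed p) (fun z => RInt (speed p) c z) c).
      * generalize (locally_pos y Hy). apply filter_imp. exact Hex.
      * apply continuous_speed; assumption.
    + apply Rplus_0_l.
Qed.

Lemma Rpower_le_1 y s : 0 < y <= 1 -> 0 <= s -> Rpower y s <= 1.
Proof.
  intros Hy Hs. replace 1 with (Rpower 1 s); [apply Rle_Rpower_l; lra|].
  unfold Rpower. rewrite ln_1, Rmult_0_r. apply exp_0.
Qed.

(** Near the vacuum [p' = kappa1 (gamma rho^(gamma - 1) (1 + P) + rho^gamma P')]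
    and [gamma - 1 = 2 theta]; the bounds on [P] and [P'] give
    [p' = O(rho^(2 theta))]. *)
Lemma speed_bound p : asymptotically_isothermal p ->
  exists theta K c, 0 < theta /\ 0 < c /\ 0 < K /\
    forall y, 0 < y <= c -> speed p y <= K * Rpower y (theta - 1).
Proof.
  intros [[_ [Hk4 Hpos]] [[gam [k1 [r [Cr [P [Hg [Hk1 [Hr [HCr [HP [_ [Heq Hbd]]]]]]]]]]]] _]].
  set (theta := (gam - 1) / 2) in *.
  set (K := k1 * (gam * (1 + Cr) + Cr)).
  assert (HK : 0 < K).
  { unfold K. apply Rmult_lt_0_compat; [lra|].
    apply Rplus_lt_0_compat; [apply Rmult_lt_0_compat|]; lra. }
  exists theta, (sqrt K), (Rmin r 1 / 2).
  assert (Hth : 0 < theta) by (unfold theta; lra).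
  assert (Hm : 0 < Rmin r 1) by (apply Rmin_glb_lt; lra).
  split; [exact Hth|]. split; [lra|]. split; [apply sqrt_lt_R0, HK|].
  intros y Hy.
  assert (Hyr : 0 < y < r) by (generalize (Rmin_l r 1); lra).
  assert (Hy1 : 0 < y <= 1) by (generalize (Rmin_r r 1); lra).
  set (t := Rpower y (2 * theta)).
  assert (Ht0 : 0 < t) by apply exp_pos.
  assert (Ht1 : t <= 1) by (apply Rpower_le_1; lra).
  assert (HdP : is_derive P y (Derive P y))
    by (apply Derive_correct, (Ck_pos_ex_derive 4 P 0); [exact HP|lia|lra]).
  assert (Hdpow : is_derive (fun x => Rpower x gam) y (gam * Rpower y (gam - 1)))
    by (apply is_derive_Reals, derivable_pt_lim_power; lra).
  assert (Hd : Derive p y =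
    k1 * (gam * t * (1 + P y) + Rpower y gam * Derive P y)).
  { apply is_derive_unique.
    apply (is_derive_ext_loc (fun x => k1 * (Rpower x gam * (1 + P x)))).
    - exists (mkposreal (Rmin y (r - y)) ltac:(apply Rmin_glb_lt; lra)).
      intros x Hx. apply Rabs_lt_between' in Hx; simpl in Hx.
      assert (H1 := Rmin_l y (r - y)). assert (H2 := Rmin_r y (r - y)).
      rewrite Heq, Rmult_assoc by lra. reflexivity.
    - eapply is_derive_eq.
      + apply (is_derive_scal (fun x => Rpower x gam * (1 + P x)) y k1).
        apply is_derive_Rmult; [exact Hdpow|].
        apply is_derive_Rplus; [apply (is_derive_const 1)|exact HdP].
      + unfold t. replace (2 * theta) with (gam - 1) by (unfold theta; field).
        Rmodule. ring. }
  assert (HP0 : Rabs (P y) <= Cr).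
  { eapply Rle_trans; [apply (Hbd 0%nat y); [lia|exact Hyr]|]. simpl.
    replace (2 * theta - 0) with (2 * theta) by ring. fold t. nra. }
  assert (HP1 : Rpower y gam * Rabs (Derive P y) <= Cr * t).
  { apply Rle_trans with (Rpower y gam * (Cr * Rpower y (2 * theta - 1))).
    - apply Rmult_le_compat_l; [apply Rlt_le, exp_pos|].
      apply (Hbd 1%nat y); [lia|exact Hyr].
    - replace (Rpower y gam * (Cr * Rpower y (2 * theta - 1))) with (Cr * (t * t)).
      + apply Rmult_le_compat_l; nra.
      + unfold t. rewrite <- Rpower_plus.
        replace (2 * theta + 2 * theta) with (gam + (2 * theta - 1))
          by (unfold theta; field).
        rewrite Rpower_plus. ring. }
  assert (Hle : Derive p y <= K * t).
  { rewrite Hd. replace (K * t) with (k1 * ((gam * (1 + Cr) + Cr) * t)) by (unfold K; ring).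
    apply Rmult_le_compat_l; [lra|].
    apply Rabs_le_between in HP0.
    assert (Rpower y gam * Derive P y <= Cr * t).
    { eapply Rle_trans; [|exact HP1]. apply Rmult_le_compat_l; [apply Rlt_le, exp_pos|].
      apply Rle_abs. }
    assert (gam * t * (1 + P y) <= gam * t * (1 + Cr)).
    { apply Rmult_le_compat_l; [|lra]. apply Rmult_le_pos; lra. }
    nra. }
  unfold speed.
  replace (sqrt K * Rpower y (theta - 1)) with (sqrt (K * t) / y).
  - apply Rmult_le_compat_r; [apply Rlt_le, Rinv_0_lt_compat; lra|].
    apply sqrt_le_1_alt, Hle.
  - rewrite sqrt_mult by lra.
    replace t with (Rpower y theta * Rpower y theta)
      by (unfold t; rewrite <- Rpower_plus; f_equal; ring).
    rewrite sqrt_square by (apply Rlt_le, exp_pos).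
    unfold Rdiv. rewrite Rmult_assoc. f_equal.
    unfold Rminus. rewrite Rpower_plus, Rpower_Ropp, Rpower_1 by lra. reflexivity.
Qed.

Lemma speed_integrable p : asymptotically_isothermal p ->
  exists c l, 0 < c /\ is_RInt_gen (speed p) (at_right 0) (at_point c) l.
Proof.
  intro hp. destruct (speed_bound p hp) as [theta [K [c [Hth [Hc [HK Hb]]]]]].
  destruct hp as [[_ [Hk4 Hpos]] _].
  assert (Hp1 : forall y, 0 < y -> 0 < Derive p y) by (intros; apply Hpos; assumption).
  set (A := fun y => K / theta * Rpower y theta).
  assert (HA : forall y, 0 < y -> is_derive A y (K * Rpower y (theta - 1))).
  { intros y Hy. eapply is_derive_eq.
    - apply (is_derive_scal (fun y => Rpower y theta) y (K / theta)).
      apply is_derive_Reals, derivable_pt_lim_power, Hy.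
    - Rmodule. field. lra. }
  assert (Hpow : forall y, 0 < y -> continuous (fun y => K * Rpower y (theta - 1)) y).
  { intros y Hy. apply continuous_Rmult; [apply continuous_const|].
    apply (ex_derive_continuous (fun y => Rpower y (theta - 1))).
    eexists; apply is_derive_Reals, derivable_pt_lim_power, Hy. }
  destruct (ex_RInt_gen_at_right (speed p) c (A c) Hc) as [l Hl].
  - intros y Hy. apply continuous_speed; assumption.
  - intros y Hy. apply Rmult_le_pos; [apply sqrt_pos|].
    apply Rlt_le, Rinv_0_lt_compat, Hy.
  - intros x Hx.
    assert (Hi : is_RInt (fun y => K * Rpower y (theta - 1)) x c (A c - A x)).
    { apply (is_RInt_derive A); intros y Hy; rewrite Rmin_left, Rmax_right in Hy by lra.
      - apply HA; lra.
      - apply Hpow; lra. }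
    apply Rle_trans with (A c - A x).
    + rewrite <- (is_RInt_unique _ _ _ _ Hi).
      apply RInt_le; [lra| |eexists; exact Hi|].
      * apply ex_RInt_cont; intros y Hy; rewrite Rmin_left, Rmax_right in Hy by lra.
        apply continuous_speed; auto; lra.
      * intros y Hy; apply Hb; lra.
    + assert (0 < A x); [|lra].
      apply Rmult_lt_0_compat; [apply Rdiv_lt_0_compat; assumption|apply exp_pos].
  - exists c, l; split; assumption.
Qed.

Lemma k_regular p : asymptotically_isothermal p ->
  (forall y, 0 < y -> 0 < Derive (k p) y) /\
  (forall y, 0 < y -> is_derive (k p) y (Derive (k p) y)) /\
  (forall y, 0 < y -> is_derive (Derive (k p)) y (Derive_n (k p) 2 y)) /\
  (forall y, 0 < y -> continuous (Derive_n (k p) 2) y).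
Proof.
  intro hp. destruct (speed_integrable p hp) as [c [l [Hc Hl]]].
  destruct hp as [[_ [Hk4 Hpos]] _].
  assert (Hp1 : forall y, 0 < y -> 0 < Derive p y) by (intros; apply Hpos; assumption).
  assert (Hk := is_derive_k p Hk4 Hp1 c l Hc Hl).
  assert (Hk1 : forall y, 0 < y -> Derive (k p) y = speed p y)
    by (intros; apply is_derive_unique, Hk; assumption).
  assert (Hd : forall y, 0 < y -> is_derive (Derive (k p)) y (speed' p y)).
  { intros y Hy. apply (is_derive_ext_loc (speed p)).
    - generalize (locally_pos y Hy). apply filter_imp. intros; symmetry; auto.
    - apply is_derive_speed; assumption. }
  assert (Hk2 : forall y, 0 < y -> Derive_n (k p) 2 y = speed' p y)
    by (intros; apply is_derive_unique, Hd; assumption).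
  split; [|split; [|split]]; intros y Hy.
  - rewrite Hk1 by exact Hy.
    apply Rdiv_lt_0_compat; [apply sqrt_lt_R0, Hp1, Hy|exact Hy].
  - rewrite Hk1 by exact Hy. apply Hk, Hy.
  - rewrite Hk2 by exact Hy. apply Hd, Hy.
  - apply (continuous_ext_loc _ (speed' p)).
    + generalize (locally_pos y Hy). apply filter_imp. intros; symmetry; auto.
    + apply continuous_speed'; assumption.
Qed.

(** * The identity for regular solutions *)

Lemma is_derive_along_curve (X Xv : R -> R -> R) (w : R -> R) (r Xr dw : R) :
  (forall r v, is_derive (X r) v (Xv r v)) -> continuity_2d_pt Xv r (w r) ->
  is_derive (fun t => X t (w r)) r Xr -> is_derive w r dw ->
  is_derive (fun t => X t (w t)) r (Xr + Xv r (w r) * dw).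
Proof.
  intros HXv Hc HXr Hw. apply is_derive_Reals.
  replace (Xr + Xv r (w r) * dw) with (Xv r (w r) * dw + Xr * 1) by ring.
  apply (derivable_pt_lim_comp_2d (fun v t => X t v) w (fun t => t)).
  - apply filterdiff_differentiable_pt_lim.
    apply (is_derive_filterdiff (fun v t => X t v) (w r) r (fun v t => Xv t v) Xr).
    + apply filter_forall. intros [v t]. apply HXv.
    + exact HXr.
    + apply (continuity_2d_pt_filterlim (fun v t => Xv t v)).
      apply (continuity_2d_pt_comp2 Xv (fun _ t => t) (fun v _ => v)); [exact Hc| |].
      * apply continuity_2d_pt_id2.
      * apply continuity_2d_pt_id1.
  - apply is_derive_Reals, Hw.
  - apply is_derive_Reals, (is_derive_id r).
Qed.

Lemma locally_open_interval (A B x : R) : A < x < B -> locally x (fun y => A < y < B).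
Proof.
  intro Hx.
  exists (mkposreal (Rmin (x - A) (B - x)) ltac:(apply Rmin_glb_lt; lra)).
  intros y Hy. apply Rabs_lt_between' in Hy; simpl in Hy.
  generalize (Rmin_l (x - A) (B - x)) (Rmin_r (x - A) (B - x)). lra.
Qed.

(** Leibniz rule for a moving symmetric interval: the horizontal sections of the
    triangle. *)
Lemma is_derive_RInt_symmetric (f f' : R -> R -> R) (w : R -> R) (A B r dw : R) :
  A < r < B ->
  (forall z y, A < z < B -> continuous (f z) y) ->
  (forall z y, A < z < B -> is_derive (fun t => f t y) z (f' z y)) ->
  (forall z y, A < z < B -> continuity_2d_pt f' z y) ->
  is_derive w r dw ->
  is_derive (fun z => RInt (f z) (- w z) (w z)) r
    (RInt (f' r) (- w r) (w r) + (f r (w r) + f r (- w r)) * dw).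
Proof.
  intros Hr Hf Hf' Hc Hw.
  assert (Hloc := locally_open_interval A B r Hr).
  assert (Hcont : forall z y, A < z < B ->
    continuity_2d_pt (fun u v => Derive (fun t => f t v) u) z y).
  { intros z y Hz. apply (continuity_2d_pt_ext_loc f'); [|apply Hc, Hz].
    destruct (locally_open_interval A B z Hz) as [del Hdel].
    exists del. intros u v Hu _. symmetry. apply is_derive_unique, Hf', Hdel, Hu. }
  assert (Hex : forall a b, locally r (fun z => ex_RInt (fun t => f z t) a b)).
  { intros a b. generalize Hloc. apply filter_imp. intros z Hz.
    apply (ex_RInt_cont (f z)). intros; apply Hf, Hz. }
  assert (Hcl : forall y, locally_2d (fun z t =>
    continuity_2d_pt (fun u v => Derive (fun t => f t v) u) z t) r y).
  { intro y. destruct Hloc as [del Hdel]. exists del. intros u v Hu _.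
    apply Hcont, Hdel, Hu. }
  assert (Hcp : forall y, continuity_pt (fun t => f r t) y)
    by (intro y; apply continuity_pt_filterlim, (Hf r y Hr)).
  eapply is_derive_eq.
  - apply (is_derive_RInt_param_bound_comp f (fun z => - w z) w r (- dw) dw); auto.
    + exists (mkposreal 1 Rlt_0_1). apply Hex.
    + exists (mkposreal 1 Rlt_0_1). apply Hex.
    + apply (is_derive_opp w r dw Hw).
    + exists (mkposreal 1 Rlt_0_1). generalize Hloc. apply filter_imp.
      intros z Hz t _. eexists. apply Hf', Hz.
  - rewrite (RInt_ext _ (f' r)).
    + Rmodule; ring.
    + intros y _. apply is_derive_unique, Hf', Hr.
Qed.

Lemma RInt_derivative_reflected (g g' : R -> R) (v w : R) :
  (forall u, is_derive g u (g' u)) -> (forall u, continuous g' u) ->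
  RInt (fun y => g' (v - y)) (- w) w = g (v + w) - g (v - w).
Proof.
  intros Hg Hg'.
  rewrite RInt_reflect by (apply ex_RInt_cont; auto).
  replace (v - - w) with (v + w) by ring.
  apply is_RInt_unique. apply (is_RInt_derive g); auto.
Qed.

(** [Y] stands for [X_rho]. With [w r = k r0 - k r], the function
    [J r = int_(-w r)^(w r) ((r - rs) Y - X)(r, v - y) dy
           + (r - rs) k'(r) (X(r, v + w r) + X(r, v - w r))]
    has derivative [(2 k' + (r - rs) k'') (X(r, v + w r) + X(r, v - w r))]: under
    the integral only [(r - rs) k'^2 X_uu] survives, it integrates to a boundary
    term, and all the derivatives of [X] at the two ends cancel against those of
    the second summand. At [r0] the section is reduced to a point, at [rs] the
    factor [r - rs] vanishes, and [J r0 - J rs] is the claim. *)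
Lemma triangle_identity (k k1 k2 : R -> R) (X Y Xv Xvv : R -> R -> R)
    (A B rs r0 v : R) :
  A < rs < r0 -> r0 < B ->
  (forall r, A < r < B -> is_derive k r (k1 r)) ->
  (forall r, A < r < B -> is_derive k1 r (k2 r)) ->
  (forall r, A < r < B -> continuous k2 r) ->
  jointly_continuous X -> jointly_continuous Xv -> jointly_continuous Xvv ->
  (forall r u, is_derive (X r) u (Xv r u)) ->
  (forall r u, is_derive (Xv r) u (Xvv r u)) ->
  (forall r u, A < r < B -> is_derive (fun t => X t u) r (Y r u)) ->
  (forall r u, A < r < B -> is_derive (fun t => Y t u) r (k1 r ^ 2 * Xvv r u)) ->
  (forall r u, A < r < B -> continuous (Y r) u) ->
  2 * (r0 - rs) * k1 r0 * X r0 v =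
    RInt (fun r => (2 * k1 r + (r - rs) * k2 r) * X r (v + k r0 - k r)) rs r0
  + RInt (fun r => (2 * k1 r + (r - rs) * k2 r) * X r (v - k r0 + k r)) rs r0
  - RInt (fun y => X rs (v - y)) (- (k r0 - k rs)) (k r0 - k rs).
Proof.
  intros HA HB Hk Hk1 Hk2 HXc HXvc HXvvc HXv HXvv HXr HYr HYc.
  set (D := fun r => 2 * k1 r + (r - rs) * k2 r).
  set (w := fun r => k r0 - k r).
  set (f := fun r y => (r - rs) * Y r (v - y) - X r (v - y)).
  set (J := fun r => RInt (f r) (- w r) (w r)
      + (r - rs) * k1 r * (X r (v + w r) + X r (v - w r))).
  assert (Hw : forall r, A < r < B -> is_derive w r (- k1 r)).
  { intros r Hr. eapply is_derive_eq.
    - apply is_derive_Rminus; [apply (is_derive_const (k r0))|apply Hk, Hr].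
    - Rmodule; ring. }
  assert (Hdp : forall r, A < r < B -> is_derive (fun t => X t (v + w t)) r
    (Y r (v + w r) + Xv r (v + w r) * - k1 r)).
  { intros r Hr.
    apply (is_derive_along_curve X Xv (fun t => v + w t)); [exact HXv|apply HXvc| |].
    - apply HXr, Hr.
    - eapply is_derive_eq.
      + apply is_derive_Rplus; [apply (is_derive_const v)|apply Hw, Hr].
      + Rmodule; ring. }
  assert (Hdm : forall r, A < r < B -> is_derive (fun t => X t (v - w t)) r
    (Y r (v - w r) + Xv r (v - w r) * k1 r)).
  { intros r Hr.
    apply (is_derive_along_curve X Xv (fun t => v - w t)); [exact HXv|apply HXvc| |].
    - apply HXr, Hr.
    - eapply is_derive_eq.
      + apply is_derive_Rminus; [apply (is_derive_const v)|apply Hw, Hr].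
      + Rmodule; ring. }
  assert (Hrk : forall r, A < r < B ->
    is_derive (fun t => (t - rs) * k1 t) r (k1 r + (r - rs) * k2 r)).
  { intros r Hr. eapply is_derive_eq.
    - apply is_derive_Rmult; [|apply Hk1, Hr].
      apply is_derive_Rminus; [apply (is_derive_id r)|apply (is_derive_const rs)].
    - Rmodule; ring. }
  assert (HJ : forall r, A < r < B ->
    is_derive J r (D r * X r (v + w r) + D r * X r (v - w r))).
  { intros r Hr. eapply is_derive_eq.
    - apply is_derive_Rplus.
      + apply (is_derive_RInt_symmetric f
          (fun r y => (r - rs) * k1 r ^ 2 * Xvv r (v - y)) w A B); [exact Hr| | | |].
        * intros z y Hz. apply continuous_Rminus.
          -- apply continuous_Rmult; [apply continuous_const|].
             apply (continuous_reflect (Y z)), HYc, Hz.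
          -- apply (continuous_reflect (X z)), continuous_section, HXc.
        * intros z y Hz. eapply is_derive_eq.
          -- apply is_derive_Rminus; [|apply HXr, Hz].
             apply is_derive_Rmult; [|apply HYr, Hz].
             apply is_derive_Rminus; [apply (is_derive_id z)|apply (is_derive_const rs)].
          -- Rmodule; ring.
        * intros z y Hz. apply continuity_2d_pt_mult.
          -- apply (continuity_2d_pt_fst (fun t => (t - rs) * k1 t ^ 2)).
             assert (Hk1c : continuous k1 z)
               by (apply (ex_derive_continuous k1); eexists; apply Hk1, Hz).
             apply continuous_Rmult.
             ++ apply continuous_Rminus; [apply continuous_id|apply continuous_const].
             ++ apply continuous_Rmult; [exact Hk1c|].
                apply continuous_Rmult; [exact Hk1c|apply continuous_const].
          -- apply (continuity_2d_pt_comp2 Xvv (fun t _ => t) (fun _ y => v - y)).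
             ++ apply HXvvc.
             ++ apply continuity_2d_pt_id1.
             ++ apply continuity_2d_pt_minus;
                  [apply continuity_2d_pt_const|apply continuity_2d_pt_id2].
        * apply Hw, Hr.
      + apply is_derive_Rmult; [apply Hrk, Hr|].
        apply is_derive_Rplus; [apply Hdp, Hr|apply Hdm, Hr].
    - rewrite RInt_Rscal.
      + rewrite (RInt_derivative_reflected (Xv r) (Xvv r));
          [|apply HXvv|intro; apply continuous_section, HXvvc].
        unfold f, D. replace (v - - w r) with (v + w r) by ring. ring.
      + apply ex_RInt_cont. intros.
        apply (continuous_reflect (Xvv r)), continuous_section, HXvvc. }
  assert (Hcurve : forall (s : R -> R), (forall r, A < r < B -> continuous s r) ->
    forall r, A < r < B -> continuous (fun r => D r * X r (s r)) r).
  { intros s Hs r Hr.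
    assert (Hk1c : continuous k1 r)
      by (apply (ex_derive_continuous k1); eexists; apply Hk1, Hr).
    apply continuous_Rmult.
    - apply continuous_Rplus.
      + apply continuous_Rmult; [apply continuous_const|exact Hk1c].
      + apply continuous_Rmult; [|apply Hk2, Hr].
        apply continuous_Rminus; [apply continuous_id|apply continuous_const].
    - apply (continuous_along_curve X (fun t => t) s);
        [apply HXc|apply continuous_id|apply Hs, Hr]. }
  assert (Hwc : forall r, A < r < B -> continuous w r)
    by (intros r Hr; apply (ex_derive_continuous w); eexists; apply Hw, Hr).
  assert (Hcp := Hcurve (fun r => v + w r)
    (fun r Hr => continuous_Rplus _ _ r (continuous_const v r) (Hwc r Hr))).
  assert (Hcm := Hcurve (fun r => v - w r)
    (fun r Hr => continuous_Rminus _ _ r (continuous_const v r) (Hwc r Hr))).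
  assert (Hin : forall r, Rmin rs r0 <= r <= Rmax rs r0 -> A < r < B)
    by (intros r Hr; rewrite Rmin_left, Rmax_right in Hr by lra; lra).
  assert (HI : RInt (fun r => D r * X r (v + w r) + D r * X r (v - w r)) rs r0
               = J r0 - J rs).
  { apply is_RInt_unique, (is_RInt_derive J).
    - intros r Hr. apply HJ, Hin, Hr.
    - intros r Hr. apply continuous_Rplus; [apply Hcp|apply Hcm]; apply Hin, Hr. }
  rewrite RInt_Rplus in HI; try (apply ex_RInt_cont; intros r Hr);
    [|apply Hcp, Hin, Hr|apply Hcm, Hin, Hr].
  assert (HJ0 : J r0 = 2 * (r0 - rs) * k1 r0 * X r0 v).
  { unfold J, w. rewrite Rminus_diag, Ropp_0, RInt_point, Rplus_0_r, Rminus_0_r.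
    Rmodule; ring. }
  assert (HJs : J rs = - RInt (fun y => X rs (v - y)) (- w rs) (w rs)).
  { unfold J. rewrite Rminus_diag, Rmult_0_l, Rmult_0_l, Rplus_0_r.
    replace (- RInt (fun y => X rs (v - y)) (- w rs) (w rs))
      with (-1 * RInt (fun y => X rs (v - y)) (- w rs) (w rs)) by ring.
    rewrite <- RInt_Rscal.
    - apply RInt_ext. intros y _. unfold f. Rmodule; ring.
    - apply ex_RInt_cont. intros. apply (continuous_reflect (X rs)), continuous_section, HXc. }
  rewrite HJ0, HJs in HI. fold (w rs).
  rewrite (RInt_ext (fun r => D r * X r (v + k r0 - k r)) (fun r => D r * X r (v + w r)))
    by (intros; unfold w; f_equal; f_equal; ring).
  rewrite (RInt_ext (fun r => D r * X r (v - k r0 + k r)) (fun r => D r * X r (v - w r)))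
    by (intros; unfold w; f_equal; f_equal; ring).
  lra.
Qed.

(** * Distributional solutions *)

Lemma Rmax_lipschitz x y c : Rabs (Rmax x c - Rmax y c) <= Rabs (x - y).
Proof.
  unfold Rmax; destruct (Rle_dec x c), (Rle_dec y c);
    unfold Rabs; repeat destruct (Rcase_abs _); lra.
Qed.

(** A solution is only meaningful for [rho >= 0]; freezing it below a height
    under the triangle makes it continuous on the whole plane. *)
Definition freeze_below (c : R) (chi : R -> R -> R) (r u : R) : R := chi (Rmax r c) u.

Lemma freeze_below_above c chi r u : c <= r -> freeze_below c chi r u = chi r u.
Proof. intro H; unfold freeze_below; rewrite Rmax_left; auto. Qed.

Lemma jointly_continuous_freeze_below c chi :
  0 < c -> locally_Holder chi -> jointly_continuous (freeze_below c chi).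
Proof.
  intros Hc Hh x y eps. assert (Heps := cond_pos eps).
  set (M := Rabs x + Rabs y + c + 2).
  assert (Hx0 := Rabs_pos x). assert (Hy0 := Rabs_pos y).
  destruct (Hh M ltac:(unfold M; lra)) as [a [C [Ha [HC Hbd]]]].
  set (eta := Rpower (eps / (C + 1)) (/ a)).
  assert (Heta : 0 < eta) by apply exp_pos.
  assert (Hq : 0 < eps / (C + 1)) by (apply Rdiv_lt_0_compat; lra).
  exists (mkposreal (Rmin 1 (eta / 2)) ltac:(apply Rmin_glb_lt; lra)).
  simpl. intros u v Hu Hv. unfold freeze_below.
  assert (Hu1 := Rlt_le_trans _ _ _ Hu (Rmin_l _ _)).
  assert (Hu2 := Rlt_le_trans _ _ _ Hu (Rmin_r _ _)).
  assert (Hv1 := Rlt_le_trans _ _ _ Hv (Rmin_l _ _)).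
  assert (Hv2 := Rlt_le_trans _ _ _ Hv (Rmin_r _ _)).
  assert (Hlip := Rmax_lipschitz u x c).
  assert (Hbx : - Rabs x <= x <= Rabs x) by (apply Rabs_le_between; lra).
  assert (Hby : - Rabs y <= y <= Rabs y) by (apply Rabs_le_between; lra).
  assert (Hmax : forall z, z <= Rabs x + 1 -> 0 <= Rmax z c <= M).
  { intros z Hz. unfold M, Rmax; destruct (Rle_dec z c); lra. }
  apply Rabs_lt_between' in Hu1. assert (Hv1' := Hv1). apply Rabs_lt_between' in Hv1'.
  assert (Hb : Rabs (chi (Rmax u c) v - chi (Rmax x c) y) <=
               C * Rpower (Rabs (Rmax u c - Rmax x c) + Rabs (v - y)) a)
    by (apply Hbd; try apply Hmax; unfold M; lra).
  set (s := Rabs (Rmax u c - Rmax x c) + Rabs (v - y)) in *.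
  assert (Hs1 := Rabs_pos (Rmax u c - Rmax x c)). assert (Hs2 := Rabs_pos (v - y)).
  destruct (Req_dec s 0) as [Hs|Hs].
  - assert (E1 : Rmax u c - Rmax x c = 0) by (apply Rabs_eq_0; unfold s in Hs; lra).
    assert (E2 : v - y = 0) by (apply Rabs_eq_0; unfold s in Hs; lra).
    replace (Rmax u c) with (Rmax x c) by lra. replace v with y by lra.
    rewrite Rminus_diag, Rabs_R0. exact Heps.
  - assert (Hs0 : 0 < s) by (unfold s in *; lra).
    assert (Hse : s <= eta) by (unfold s; lra).
    assert (Hp : Rpower s a <= eps / (C + 1)).
    { apply Rle_trans with (Rpower eta a); [apply Rle_Rpower_l; lra|].
      unfold eta. rewrite Rpower_mult, Rinv_l, Rpower_1 by lra. lra. }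
    eapply Rle_lt_trans; [exact Hb|].
    apply Rle_lt_trans with (C * (eps / (C + 1))); [apply Rmult_le_compat_l; assumption|].
    apply (Rmult_lt_reg_r (C + 1)); [lra|].
    replace (C * (eps / (C + 1)) * (C + 1)) with (C * eps) by (field; lra). nra.
Qed.

(** The weak equation tested with [phi rho * eta (v - u)]: the inner integrals are
    convolutions of [chi] with [eta] and [eta'']. *)
Lemma mollified_weak_equation p chi e eta v a0 b0 phi :
  jointly_continuous (freeze_below a0 chi) -> entropy_equation p chi ->
  0 < e -> smooth eta -> (forall x, x <= - e \/ e <= x -> eta x = 0) ->
  0 < a0 < b0 -> smooth phi -> (forall x, phi x <> 0 -> a0 <= x <= b0) ->
  RInt (fun s => Derive (Derive phi) s * conv e (freeze_below a0 chi) eta s v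
    - phi s * (Derive (k p) (Rmax s a0) ^ 2
               * conv e (freeze_below a0 chi) (Derive (Derive eta)) s v)) a0 b0 = 0.
Proof.
  intros Hc Heq He Heta Hsup Hab Hphi Hphis.
  assert (Heta1 := smooth_Derive _ Heta). assert (Heta2 := smooth_Derive _ Heta1).
  assert (Hsup1 := smooth_support_Derive e eta Heta Hsup).
  assert (Hsup2 := smooth_support_Derive e _ Heta1 Hsup1).
  set (M := Rabs v + e + 1). set (Phi := fun r u => phi r * eta (v - u)).
  assert (Hv : - Rabs v <= v <= Rabs v) by (apply Rabs_le_between; lra).
  assert (Htest : test_fun2 a0 b0 M Phi).
  { split; [exact Hab|]. split; [unfold M; lra|]. split.
    - intros n r u. apply (ex_diff_n_tensor n phi (fun u => eta (v - u)));
        [apply Hphi|apply smooth_reflect, Heta].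
    - intros r u Hne. split.
      + apply Hphis. intro E. apply Hne. unfold Phi. rewrite E. ring.
      + destruct (Rle_dec (v - u) (- e)) as [H1|H1];
          [elim Hne; unfold Phi; rewrite Hsup by (left; exact H1); ring|].
        destruct (Rle_dec e (v - u)) as [H2|H2];
          [elim Hne; unfold Phi; rewrite Hsup by (right; exact H2); ring|].
        unfold M; lra. }
  rewrite <- (Heq a0 b0 M Phi Htest). apply RInt_ext. intros r Hr.
  rewrite Rmin_left, Rmax_right in Hr by lra.
  rewrite Rmax_left by lra.
  assert (Hsec : forall u, continuous (freeze_below a0 chi r) u)
    by (intro; apply continuous_section, Hc).
  rewrite !(conv_as_fixed_integral e (freeze_below a0 chi) _ r v (- M) M); auto;
    try (intro; apply smooth_continuous; assumption); try (unfold M; lra).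
  symmetry.
  rewrite (RInt_ext _ (fun u =>
    Derive (Derive phi) r * (freeze_below a0 chi r u * eta (v - u))
    - phi r * Derive (k p) r ^ 2
      * (freeze_below a0 chi r u * Derive (Derive eta) (v - u)))).
  - assert (Hex : forall g, smooth g ->
      ex_RInt (fun u => freeze_below a0 chi r u * g (v - u)) (- M) M).
    { intros g Hg. apply ex_RInt_cont. intros u _. apply continuous_Rmult; [apply Hsec|].
      apply (continuous_reflect g), smooth_continuous, Hg. }
    rewrite RInt_Rminus, !RInt_Rscal; auto using ex_RInt_Rscal.
    Rmodule; ring.
  - intros u _. rewrite freeze_below_above by lra.
    assert (E1 : partial_derive 2 0 Phi r u = Derive (Derive phi) r * eta (v - u)).
    { unfold partial_derive; simpl. unfold Phi.
      rewrite (Derive_ext _ (fun t => Derive phi t * eta (v - u)))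
        by (intro; apply Derive_scal_l).
      apply Derive_scal_l. }
    assert (E2 : partial_derive 0 2 Phi r u = phi r * Derive (Derive eta) (v - u)).
    { unfold partial_derive; simpl. unfold Phi.
      rewrite (Derive_ext _ (fun t => phi r * Derive (fun z => eta (v - z)) t))
        by (intro; apply Derive_scal).
      rewrite Derive_scal, Derive2_reflect by exact Heta. reflexivity. }
    rewrite E1, E2. Rmodule; ring.
Qed.

Lemma continuous_RInt_param (m : R -> R) (Z : R -> R -> R) (a b u : R) :
  a <= b -> jointly_continuous Z -> (forall s, continuous m s) ->
  continuous (fun u => RInt (fun s => m s * Z s u) a b) u.
Proof.
  intros Hab HZ Hm.
  set (N := RInt (fun s => Rabs (m s)) a b).
  assert (HN : 0 <= N).
  { apply RInt_ge_0; [lra| |intros; apply Rabs_pos].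
    apply ex_RInt_cont. intros; apply continuous_Rabs_comp, Hm. }
  assert (Hsec : forall s t, continuous (fun s => Z s t) s).
  { intros s t. apply (continuous_along_curve Z (fun s => s) (fun _ => t));
      [apply HZ|apply continuous_id|apply continuous_const]. }
  assert (Hex : forall t, ex_RInt (fun s => m s * Z s t) a b).
  { intro t. apply ex_RInt_cont. intros; apply continuous_Rmult; auto. }
  apply filterlim_locally. intro eps. assert (Heps := cond_pos eps).
  assert (Hep : 0 < eps / (N + 1)) by (apply Rdiv_lt_0_compat; lra).
  destruct (uniform_continuity_2d Z a b (u - 1) (u + 1)
              (fun x y _ _ => HZ x y) (mkposreal _ Hep)) as [del Hdel].
  simpl in Hdel. assert (Hdp := cond_pos del).
  exists (mkposreal (Rmin 1 del) ltac:(apply Rmin_glb_lt; lra)). intros t Ht.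
  change (Rabs (t - u) < Rmin 1 del) in Ht.
  assert (Ht1 := Rlt_le_trans _ _ _ Ht (Rmin_l _ _)).
  assert (Ht2 := Rlt_le_trans _ _ _ Ht (Rmin_r _ _)).
  apply Rabs_lt_between' in Ht1.
  change (Rabs (RInt (fun s => m s * Z s t) a b - RInt (fun s => m s * Z s u) a b) < eps).
  rewrite <- RInt_Rminus by apply Hex.
  rewrite (RInt_ext _ (fun s => (Z s t - Z s u) * m s)) by (intros; Rmodule; ring).
  apply Rle_lt_trans with (eps / (N + 1) * N).
  - apply abs_RInt_mult_le; [exact Hab| |intros; apply Hm|].
    + apply ex_RInt_cont. intros s _. apply continuous_Rmult; [|apply Hm].
      apply continuous_Rminus; apply Hsec.
    + intros s Hs. apply Rlt_le, Hdel; try lra.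
      rewrite Rminus_diag, Rabs_R0; exact Hdp.
  - apply (Rmult_lt_reg_r (N + 1)); [lra|].
    replace (eps / (N + 1) * N * (N + 1)) with (eps * N) by (field; lra).
    apply Rmult_lt_compat_l; lra.
Qed.

(** Cauchy's formula for a repeated integral; in this form the dependence of the
    integral on a parameter of [G] needs only one passage under the integral. *)
Lemma RInt_iterated (G : R -> R) (A B : R) :
  (forall s, continuous G s) ->
  RInt (fun t => RInt G A t) A B = RInt (fun s => (B - s) * G s) A B.
Proof.
  intro HG.
  assert (HD := is_derive_RInt_continuous G A).
  assert (Hc : forall t, continuous (fun t => RInt G A t) t)
    by (intro t; apply (ex_derive_continuous (fun t => RInt G A t)); eexists; apply HD, HG).
  assert (Hc2 : forall s, continuous (fun s => (B - s) * G s) s).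
  { intro s. apply continuous_Rmult; [|apply HG].
    apply continuous_Rminus; [apply continuous_const|apply continuous_id]. }
  assert (HI : RInt (fun t => (B - t) * G t - RInt G A t) A B = 0).
  { apply is_RInt_unique.
    replace 0 with ((B - B) * RInt G A B - (B - A) * RInt G A A).
    - apply (is_RInt_derive (fun t => (B - t) * RInt G A t)).
      + intros t _. eapply is_derive_eq.
        * apply is_derive_Rmult; [|apply HD, HG].
          apply is_derive_Rminus; [apply (is_derive_const B)|apply (is_derive_id t)].
        * Rmodule; ring.
      + intros t _. apply continuous_Rminus; auto.
    - rewrite RInt_point. Rmodule; ring. }
  rewrite RInt_Rminus in HI by (apply ex_RInt_cont; auto).
  symmetry. apply Rminus_diag_uniq, HI.
Qed.

(** The mollified kernel satisfies the hypotheses of [triangle_identity]: by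
    [second_derivative_of_distributional], [X(., u)] is, on a neighbourhood of
    [[rs, r0]], an affine function plus the second primitive of [k'^2 X_uu],
    which also gives the formula [Y] for its derivative. *)
Lemma mollified_identity p chi e eta rs r0 v :
  asymptotically_isothermal p -> entropy_equation p chi ->
  jointly_continuous (freeze_below (rs / 4) chi) ->
  0 < rs < r0 -> 0 < e -> smooth eta ->
  (forall x, x <= - e \/ e <= x -> eta x = 0) ->
  let X := conv e (freeze_below (rs / 4) chi) eta in
  let D := fun r => 2 * Derive (k p) r + (r - rs) * Derive_n (k p) 2 r in
  2 * (r0 - rs) * Derive (k p) r0 * X r0 v =
    RInt (fun r => D r * X r (v + k p r0 - k p r)) rs r0
  + RInt (fun r => D r * X r (v - k p r0 + k p r)) rs r0
  - RInt (fun y => X rs (v - y)) (- (k p r0 - k p rs)) (k p r0 - k p rs).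
Proof.
  intros Hp Heq Hc Hr He Heta Hsup X D.
  destruct (k_regular p Hp) as [Hkpos [Hk [Hk1 Hk2]]].
  set (chi' := freeze_below (rs / 4) chi) in *.
  assert (Heta1 := smooth_Derive _ Heta). assert (Heta2 := smooth_Derive _ Heta1).
  assert (Hsup1 := smooth_support_Derive e eta Heta Hsup).
  assert (HcX : forall g, smooth g -> jointly_continuous (conv e chi' g))
    by (intros g Hg; apply jointly_continuous_conv; auto;
        intro; apply smooth_continuous, Hg).
  set (Xvv := conv e chi' (Derive (Derive eta))).
  (* [k'] is only regular for positive arguments, so it is frozen like [chi] *)
  set (q := fun s => Derive (k p) (Rmax s (rs / 4)) ^ 2).
  assert (Hmaxc : forall s, continuous (fun s => Rmax s (rs / 4)) s).
  { intro s. apply filterlim_locally. intro eps. exists eps. intros t Ht.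
    eapply Rle_lt_trans; [apply Rmax_lipschitz|exact Ht]. }
  assert (Hq : forall s, continuous q s).
  { intro s. assert (H1 : continuous (fun s => Derive (k p) (Rmax s (rs / 4))) s).
    { apply (continuous_Rcomp (fun s => Rmax s (rs / 4)) (Derive (k p))); [apply Hmaxc|].
      apply (ex_derive_continuous (Derive (k p))). eexists. apply Hk1.
      apply Rlt_le_trans with (rs / 4); [lra|apply Rmax_r]. }
    apply continuous_Rmult; [exact H1|].
    apply continuous_Rmult; [exact H1|apply continuous_const]. }
  set (A := rs / 2). set (B := r0 + 1).
  set (G := fun u s => q s * Xvv s u).
  assert (Hcol : forall Z s u, jointly_continuous Z -> continuous (fun s => Z s u) s).
  { intros Z s u HZ. apply (continuous_along_curve Z (fun s => s) (fun _ => u));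
      [apply HZ|apply continuous_id|apply continuous_const]. }
  assert (HG : forall u s, continuous (G u) s)
    by (intros u s; apply continuous_Rmult; [apply Hq|apply Hcol, HcX, Heta2]).
  set (H := fun u x => RInt (fun t => RInt (G u) A t) A x).
  assert (HA : 0 < A /\ rs / 4 < A < rs) by (unfold A; lra).
  assert (HB : r0 < B < r0 + 2) by (unfold B; lra).
  assert (Hform : forall u x, A <= x <= B ->
    X x u = H u x + X A u * ((B - x) / (B - A))
            + (X B u - H u B) * ((x - A) / (B - A))).
  { intros u x Hx.
    apply (second_derivative_of_distributional (fun s => X s u) (G u) (rs / 4) A B (r0 + 2));
      try lra.
    - intro s. apply Hcol, HcX, Heta.
    - apply HG.
    - intros phi Hphi Hphis. unfold G, q.
      apply (mollified_weak_equation p chi e eta u (rs / 4) (r0 + 2) phi); auto; lra. }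
  set (Y := fun r u => RInt (G u) A r + ((X B u - H u B) - X A u) / (B - A)).
  assert (HHB : forall u, H u B = RInt (fun s => ((B - s) * q s) * Xvv s u) A B).
  { intro u. unfold H. rewrite RInt_iterated by apply HG.
    apply RInt_ext. intros; unfold G; Rmodule; ring. }
  apply (triangle_identity (k p) (Derive (k p)) (Derive_n (k p) 2)
           X Y (conv e chi' (Derive eta)) Xvv A B rs r0 v); try lra.
  - intros r Hr'. apply Hk; lra.
  - intros r Hr'. apply Hk1; lra.
  - intros r Hr'. apply Hk2; lra.
  - apply HcX, Heta.
  - apply HcX, Heta1.
  - apply HcX, Heta2.
  - intros r u. apply is_derive_conv; auto.
  - intros r u. apply is_derive_conv; auto.
  - intros r u Hr'.
    apply (is_derive_ext_loc (fun x => H u x + X A u * ((B - x) / (B - A))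
            + (X B u - H u B) * ((x - A) / (B - A)))).
    + generalize (locally_open_interval A B r Hr'). apply filter_imp.
      intros x Hx. symmetry. apply Hform; lra.
    + eapply is_derive_eq.
      * apply is_derive_Rplus; [apply is_derive_Rplus|].
        -- apply (is_derive_RInt_continuous (fun t => RInt (G u) A t)).
           intro t. apply (ex_derive_continuous (fun t => RInt (G u) A t)).
           eexists. apply is_derive_RInt_continuous, HG.
        -- apply (is_derive_scal (fun x => (B - x) / (B - A)) r (X A u) (- / (B - A))).
           auto_derive; [trivial|]. unfold Rdiv. ring.
        -- apply (is_derive_scal (fun x => (x - A) / (B - A)) r (X B u - H u B) (/ (B - A))).
           auto_derive; [trivial|]. unfold Rdiv. ring.
      * unfold Y, Rdiv. Rmodule; ring.
  - intros r u Hr'. eapply is_derive_eq.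
    + apply is_derive_Rplus; [apply is_derive_RInt_continuous, HG|].
      apply (is_derive_const (((X B u - H u B) - X A u) / (B - A))).
    + unfold G, q. rewrite Rmax_left by lra. Rmodule; ring.
  - intros r u Hr'. apply continuous_Rplus.
    + apply (continuous_RInt_param q Xvv A r u); [lra|apply HcX, Heta2|exact Hq].
    + apply continuous_Rmult; [|apply continuous_const].
      apply continuous_Rminus; [apply continuous_Rminus|];
        try (apply continuous_section, HcX, Heta).
      apply (continuous_ext (fun u => RInt (fun s => ((B - s) * q s) * Xvv s u) A B)).
      * intro; symmetry; apply HHB.
      * apply continuous_RInt_param; [lra|apply HcX, Heta2|].
        intro s. apply continuous_Rmult; [|apply Hq].
        apply continuous_Rminus; [apply continuous_const|apply continuous_id].
Qed.

Lemma k_increasing p x y : asymptotically_isothermal p -> 0 < x <= y -> k p x <= k p y.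
Proof.
  intros Hp Hxy. destruct (k_regular p Hp) as [Hpos [Hk _]].
  destruct (MVT_gen (k p) x y (Derive (k p))) as [c [Hc E]];
    rewrite ?Rmin_left, ?Rmax_right in * by lra.
  - intros z Hz. apply Hk; lra.
  - intros z Hz. apply continuity_pt_filterlim, (ex_derive_continuous (k p)).
    eexists; apply Hk; lra.
  - assert (0 < Derive (k p) c) by (apply Hpos; lra). nra.
Qed.

Lemma abs_RInt_weighted_diff (g X1 X2 : R -> R) (a b del : R) :
  a <= b -> (forall t, a <= t <= b -> continuous g t) ->
  (forall t, a <= t <= b -> continuous X1 t) -> (forall t, a <= t <= b -> continuous X2 t) ->
  (forall t, a <= t <= b -> Rabs (X1 t - X2 t) <= del) ->
  Rabs (RInt (fun t => g t * X1 t) a b - RInt (fun t => g t * X2 t) a b)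
  <= del * RInt (fun t => Rabs (g t)) a b.
Proof.
  intros Hab Hg H1 H2 Hd.
  rewrite <- RInt_Rminus by (apply ex_RInt_cont; intros t Ht;
    rewrite Rmin_left, Rmax_right in Ht by lra; apply continuous_Rmult; auto).
  rewrite (RInt_ext _ (fun t => (X1 t - X2 t) * g t)) by (intros; Rmodule; ring).
  apply abs_RInt_mult_le; auto. apply ex_RInt_cont; intros t Ht.
  rewrite Rmin_left, Rmax_right in Ht by lra.
  apply continuous_Rmult; auto. apply continuous_Rminus; auto.
Qed.

(** Both sides of [mollified_identity] change by at most a constant times [del]
    when the mollified function is replaced by [chi], once they are within [del]
    of each other on a rectangle containing the triangle. *)
Lemma domain_of_dependence_identity p chi rs r0 v :
  asymptotically_isothermal p -> entropy_equation p chi -> locally_Holder chi ->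
  0 < rs < r0 ->
  let D := fun r => 2 * Derive (k p) r + (r - rs) * Derive_n (k p) 2 r in
  2 * (r0 - rs) * Derive (k p) r0 * chi r0 v =
    RInt (fun r => D r * chi r (v + k p r0 - k p r)) rs r0
  + RInt (fun r => D r * chi r (v - k p r0 + k p r)) rs r0
  - RInt (fun y => chi rs (v - y)) (- (k p r0 - k p rs)) (k p r0 - k p rs).
Proof.
  intros Hp Heq Hh Hr D.
  destruct (k_regular p Hp) as [Hkpos [Hk [Hk1 Hk2]]].
  set (chi' := freeze_below (rs / 4) chi).
  assert (Hc : jointly_continuous chi') by (apply jointly_continuous_freeze_below; auto; lra).
  assert (Heqc : forall r u, rs <= r -> chi' r u = chi r u)
    by (intros; apply freeze_below_above; lra).
  set (L := k p r0 - k p rs).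
  assert (HL : 0 <= L) by (unfold L; generalize (k_increasing p rs r0 Hp ltac:(lra)); lra).
  assert (Hkb : forall r, rs <= r <= r0 -> 0 <= k p r0 - k p r <= L).
  { intros r Hr'. generalize (k_increasing p rs r Hp ltac:(lra)).
    generalize (k_increasing p r r0 Hp ltac:(lra)). unfold L; lra. }
  assert (HDc : forall r, rs <= r <= r0 -> continuous D r).
  { intros r Hr'. apply continuous_Rplus.
    - apply continuous_Rmult; [apply continuous_const|].
      apply (ex_derive_continuous (Derive (k p))). eexists. apply Hk1; lra.
    - apply continuous_Rmult; [|apply Hk2; lra].
      apply continuous_Rminus; [apply continuous_id|apply continuous_const]. }
  assert (Hkc : forall r, rs <= r <= r0 -> continuous (k p) r).
  { intros r Hr'. apply (ex_derive_continuous (k p)). eexists. apply Hk; lra. }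
  set (N := RInt (fun r => Rabs (D r)) rs r0).
  assert (HN : 0 <= N).
  { apply RInt_ge_0; [lra| |intros; apply Rabs_pos].
    apply ex_RInt_cont. intros r Hr'. rewrite Rmin_left, Rmax_right in Hr' by lra.
    apply continuous_Rabs_comp, HDc, Hr'. }
  assert (Hk0 := Hkpos r0 ltac:(lra)).
  set (K0 := 2 * (r0 - rs) * Derive (k p) r0).
  assert (HK0 : 0 < K0) by (unfold K0; apply Rmult_lt_0_compat; lra).
  rewrite <- (Heqc r0) by lra.
  rewrite (RInt_ext (fun y => chi rs (v - y)) (fun y => chi' rs (v - y)))
    by (intros; symmetry; apply Heqc; lra).
  rewrite (RInt_ext (fun r => D r * chi r (v + k p r0 - k p r))
                    (fun r => D r * chi' r (v + k p r0 - k p r)))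
    by (intros r Hr'; rewrite Rmin_left, Rmax_right in Hr' by lra; rewrite Heqc; auto; lra).
  rewrite (RInt_ext (fun r => D r * chi r (v - k p r0 + k p r))
                    (fun r => D r * chi' r (v - k p r0 + k p r)))
    by (intros r Hr'; rewrite Rmin_left, Rmax_right in Hr' by lra; rewrite Heqc; auto; lra).
  apply Rminus_diag_uniq.
  apply (Rabs_le_all_eps _ (K0 + N + N + 2 * L)); [lra|]. intros del Hdel.
  destruct (uniform_continuity_2d chi' rs r0 (v - L - 1) (v + L + 1)
              (fun x y _ _ => Hc x y) (mkposreal _ Hdel)) as [mu Hmu].
  simpl in Hmu. assert (Hmp := cond_pos mu).
  set (e := Rmin 1 mu / 2).
  assert (He : 0 < e /\ e < 1 /\ e < mu)
    by (unfold e, Rmin; destruct (Rle_dec 1 mu); lra).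
  clearbody e. destruct He as [He [He1 He2]].
  destruct (mollifier_exists e He) as [eta [Hsm [Hpos [Hsup Hint]]]].
  assert (Hetac : forall x, continuous eta x) by (intro; apply smooth_continuous, Hsm).
  set (X := conv e chi' eta).
  assert (HXc : jointly_continuous X) by (apply jointly_continuous_conv; auto).
  assert (Hclose : forall r u, rs <= r <= r0 -> v - L <= u <= v + L ->
    Rabs (X r u - chi' r u) <= del).
  { intros r u Hr' Hu. apply conv_mollifier_close; auto.
    intros u' Hu'. apply Rlt_le.
    assert (Hu2 := Hu'). apply Rabs_le_between' in Hu2.
    apply Hmu; try lra. rewrite Rminus_diag, Rabs_R0; exact Hmp. }
  assert (Hid := mollified_identity p chi e eta rs r0 v Hp Heq Hc Hr He Hsm Hsup).
  cbv zeta in Hid. fold chi' X D K0 L in Hid.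
  assert (Hcurve : forall (Z : R -> R -> R) (s : R -> R) r, jointly_continuous Z ->
    continuous s r -> continuous (fun t => Z t (s t)) r).
  { intros Z s r HZ Hs. apply (continuous_along_curve Z (fun t => t) s);
      [apply HZ|apply continuous_id|exact Hs]. }
  assert (Hsp : forall r, rs <= r <= r0 -> continuous (fun r => v + k p r0 - k p r) r)
    by (intros; apply continuous_Rminus; [apply continuous_const|auto]).
  assert (Hsm' : forall r, rs <= r <= r0 -> continuous (fun r => v - k p r0 + k p r) r)
    by (intros; apply continuous_Rplus; [apply continuous_const|auto]).
  assert (Hpath : forall s : R -> R, (forall r, rs <= r <= r0 -> continuous s r) ->
    (forall r, rs <= r <= r0 -> v - L <= s r <= v + L) ->
    Rabs (RInt (fun r => D r * X r (s r)) rs r0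
          - RInt (fun r => D r * chi' r (s r)) rs r0) <= del * N).
  { intros s Hs Hsb. apply abs_RInt_weighted_diff; auto; lra. }
  assert (E1 := Hpath _ Hsp
    (fun r Hr' => ltac:(generalize (Hkb r Hr'); lra))).
  assert (E2 := Hpath _ Hsm'
    (fun r Hr' => ltac:(generalize (Hkb r Hr'); lra))).
  assert (Hex : forall Z, jointly_continuous Z -> ex_RInt (fun y => Z rs (v - y)) (- L) L).
  { intros Z HZ. apply ex_RInt_cont. intros.
    apply (continuous_reflect (Z rs)), continuous_section, HZ. }
  assert (E3 : Rabs (RInt (fun y => X rs (v - y)) (- L) L
                     - RInt (fun y => chi' rs (v - y)) (- L) L) <= del * (2 * L)).
  { rewrite <- RInt_Rminus by auto.
    replace (del * (2 * L)) with ((L - - L) * del) by ring.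
    apply abs_RInt_le_const; [lra|apply ex_RInt_Rminus; auto|].
    intros y Hy. apply Hclose; lra. }
  assert (E0 : Rabs (K0 * X r0 v - K0 * chi' r0 v) <= del * K0).
  { replace (K0 * X r0 v - K0 * chi' r0 v) with (K0 * (X r0 v - chi' r0 v)) by ring.
    rewrite Rabs_mult, (Rabs_pos_eq K0) by lra. rewrite (Rmult_comm del).
    apply Rmult_le_compat_l; [lra|]. apply Hclose; lra. }
  fold K0 L.
  apply Rabs_le_between in E0. apply Rabs_le_between in E1.
  apply Rabs_le_between in E2. apply Rabs_le_between in E3.
  apply Rabs_le. lra.
Qed.

(** * The representation formula *)

Theorem lemma3p4 (p : R -> R) (chi : R -> R -> R)
  (hp : asymptotically_isothermal p) (hchi : entropy_kernel p chi)
  (rho0 u0 rhos : R)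
  (hu0 : - k p rho0 <= u0 <= k p rho0) (hrhos : 0 < rhos < rho0) :
  chi rho0 u0 =
    1 / (2 * (rho0 - rhos) * Derive (k p) rho0) *
      RInt (fun rho => Derive (k p) rho * d p rhos rho
                       * chi rho (u0 + k p rho0 - k p rho)) rhos rho0
  + 1 / (2 * (rho0 - rhos) * Derive (k p) rho0) *
      RInt (fun rho => Derive (k p) rho * d p rhos rho
                       * chi rho (u0 - k p rho0 + k p rho)) rhos rho0
  - 1 / (2 * (rho0 - rhos) * Derive (k p) rho0) *
      RInt (fun y => chi rhos (u0 - y))
           (- (k p rho0 - k p rhos)) (k p rho0 - k p rhos).
Proof.
  destruct hchi as [Hh [Heq _]].
  destruct (k_regular p hp) as [Hkpos _].
  assert (Hid := domain_of_dependence_identity p chi rhos rho0 u0 hp Heq Hh hrhos).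
  cbv zeta in Hid.
  assert (Hd : forall r, rhos < r < rho0 -> Derive (k p) r * d p rhos r
      = 2 * Derive (k p) r + (r - rhos) * Derive_n (k p) 2 r).
  { intros r Hr. assert (H := Hkpos r ltac:(lra)). unfold d. field. lra. }
  rewrite (RInt_ext (fun rho => Derive (k p) rho * d p rhos rho
    * chi rho (u0 + k p rho0 - k p rho)) (fun r =>
      (2 * Derive (k p) r + (r - rhos) * Derive_n (k p) 2 r)
      * chi r (u0 + k p rho0 - k p r)))
    by (intros r Hr; rewrite Rmin_left, Rmax_right in Hr by lra;
        rewrite (Hd r Hr); reflexivity).
  rewrite (RInt_ext (fun rho => Derive (k p) rho * d p rhos rho
    * chi rho (u0 - k p rho0 + k p rho)) (fun r =>
      (2 * Derive (k p) r + (r - rhos) * Derive_n (k p) 2 r)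
      * chi r (u0 - k p rho0 + k p r)))
    by (intros r Hr; rewrite Rmin_left, Rmax_right in Hr by lra;
        rewrite (Hd r Hr); reflexivity).
  assert (H0 := Hkpos rho0 ltac:(lra)).
  assert (HK : 2 * (rho0 - rhos) * Derive (k p) rho0 <> 0)
    by (apply Rgt_not_eq, Rmult_lt_0_compat; lra).
  apply (Rmult_eq_reg_l (2 * (rho0 - rhos) * Derive (k p) rho0)); [|exact HK].
  rewrite Hid at 1. Rmodule. field. split; lra.
Qed.
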